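(* Kelley–Morse set theory {\rm KM} proves the principle of open determinacy for class games: every two-player class game of perfect information whose winning class is open for one of the players has a winning strategy for one of the players. Indeed, this is provable in the subtheory {\rm GBC} + $\Pi^1_1$-comprehension.
   Context: A class game: players I and II alternately choose elements of a class $X$, producing a play in $X^\omega$; player I wins iff the play lies in a fixed class $A\subseteq X^\omega$. A strategy is a class function $X^{<\omega}\to X$, winning if every play following it is won by that player. The game is open for a player if that player's winning class is open in the product topology on $X^\omega$ with $X$ discrete. {\rm GBC} is G\''odel–Bernays set theory with global choice; $\Pi^1_1$-comprehension asserts that for any formula $\varphi(x,Z)$ of the form $\forall Y\,\psi$ with $\psi$ having only set quantifiers and $Z$ a class parameter, the class $\{a\mid\varphi(a,Z)\}$ exists. *)

(* Defs.v *)
From Stdlib Require Import List.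
Import ListNotations.

Set Implicit Arguments.

(** * Two-sorted classical logic: sets and classes

    Both sorts of variables are de Bruijn indices, counted independently of
    each other.  There are no function symbols, so terms are variables and
    substitution is renaming. *)

Inductive form : Type :=
| Bot
| SEq (x y : nat)
| CEq (X Y : nat)
| SIn (x y : nat)
| CIn (x Y : nat)
| Imp (p q : form)
| SAll (p : form)
| CAll (p : form).

Definition scons (x : nat) (f : nat -> nat) (n : nat) : nat :=
  match n with 0 => x | S k => f k end.

Definition up (f : nat -> nat) : nat -> nat := scons 0 (fun n => S (f n)).

Fixpoint ren (f g : nat -> nat) (p : form) : form :=
  match p with
  | Bot => Bot
  | SEq x y => SEq (f x) (f y)
  | CEq X Y => CEq (g X) (g Y)
  | SIn x y => SIn (f x) (f y)
  | CIn x Y => CIn (f x) (g Y)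
  | Imp p q => Imp (ren f g p) (ren f g q)
  | SAll p => SAll (ren (up f) g p)
  | CAll p => CAll (ren f (up g) p)
  end.

Definition nid (n : nat) : nat := n.

Definition sshift (p : form) : form := ren S nid p.
Definition cshift (p : form) : form := ren nid S p.
Definition sinst (p : form) (x : nat) : form := ren (scons x nid) nid p.
Definition cinst (p : form) (X : nat) : form := ren nid (scons X nid) p.

(** Every free set variable of [p] is [< n] and every free class variable
    is [< m]. *)
Fixpoint bounded (n m : nat) (p : form) : Prop :=
  match p with
  | Bot => True
  | SEq x y => x < n /\ y < n
  | CEq X Y => X < m /\ Y < m
  | SIn x y => x < n /\ y < n
  | CIn x Y => x < n /\ Y < m
  | Imp p q => bounded n m p /\ bounded n m q
  | SAll p => bounded (S n) m p
  | CAll p => bounded n (S m) p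
  end.

Definition Neg (p : form) : form := Imp p Bot.
Definition And (p q : form) : form := Neg (Imp p (Neg q)).
Definition Or (p q : form) : form := Imp (Neg p) q.
Definition Iff (p q : form) : form := And (Imp p q) (Imp q p).
Definition SEx (p : form) : form := Neg (SAll (Neg p)).
Definition CEx (p : form) : form := Neg (CAll (Neg p)).

(** Natural deduction.  The eigenvariable condition is expressed by shifting
    the context [G] only; this is sound because all theories below consist of
    sentences. *)
Inductive prv (T : form -> Prop) : list form -> form -> Prop :=
| prv_ax G p : T p -> prv T G p
| prv_hyp G p : In p G -> prv T G p
| prv_impI G p q : prv T (p :: G) q -> prv T G (Imp p q)
| prv_impE G p q : prv T G (Imp p q) -> prv T G p -> prv T G q
| prv_dne G p : prv T G (Neg (Neg p)) -> prv T G p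
| prv_sallI G p : prv T (map sshift G) p -> prv T G (SAll p)
| prv_sallE G p x : prv T G (SAll p) -> prv T G (sinst p x)
| prv_callI G p : prv T (map cshift G) p -> prv T G (CAll p)
| prv_callE G p X : prv T G (CAll p) -> prv T G (cinst p X)
| prv_srefl G x : prv T G (SEq x x)
| prv_srepl G p x y :
    prv T G (SEq x y) -> prv T G (sinst p x) -> prv T G (sinst p y)
| prv_crefl G X : prv T G (CEq X X)
| prv_crepl G p X Y :
    prv T G (CEq X Y) -> prv T G (cinst p X) -> prv T G (cinst p Y).

Definition proves (T : form -> Prop) (p : form) : Prop := prv T [] p.

(** * Named binders

    An [fm] is a formula awaiting the numbers [n], [m] of set and class
    binders above it.  Bound variables are represented by their level (the
    number of binders of the same sort above their own binder), which stays
    fixed under further binders; atoms convert levels to indices. *)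

Definition fm : Type := nat -> nat -> form.
Record svar : Type := SVar { slevel : nat }.
Record cvar : Type := CVar { clevel : nat }.

Definition index (depth level : nat) : nat := depth - S level.

Definition f_seq (x y : svar) : fm := fun n _ =>
  SEq (index n (slevel x)) (index n (slevel y)).
Definition f_ceq (X Y : cvar) : fm := fun _ m =>
  CEq (index m (clevel X)) (index m (clevel Y)).
Definition f_sin (x y : svar) : fm := fun n _ =>
  SIn (index n (slevel x)) (index n (slevel y)).
Definition f_cin (x : svar) (Y : cvar) : fm := fun n m =>
  CIn (index n (slevel x)) (index m (clevel Y)).
Definition f_neg (p : fm) : fm := fun n m => Neg (p n m).
Definition f_imp (p q : fm) : fm := fun n m => Imp (p n m) (q n m).
Definition f_and (p q : fm) : fm := fun n m => And (p n m) (q n m).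
Definition f_or (p q : fm) : fm := fun n m => Or (p n m) (q n m).
Definition f_iff (p q : fm) : fm := fun n m => Iff (p n m) (q n m).
Definition f_sall (p : svar -> fm) : fm := fun n m => SAll (p (SVar n) (S n) m).
Definition f_sex (p : svar -> fm) : fm := fun n m => SEx (p (SVar n) (S n) m).
Definition f_call (p : cvar -> fm) : fm := fun n m => CAll (p (CVar m) n (S m)).
Definition f_cex (p : cvar -> fm) : fm := fun n m => CEx (p (CVar m) n (S m)).

Definition sentence (p : fm) : form := p 0 0.

Declare Scope fm_scope.
Delimit Scope fm_scope with fm.
Bind Scope fm_scope with fm.

(** A suffix [ₛ] marks sets, [ₖ] marks classes. *)
Notation "x =ₛ y" := (f_seq x y) (at level 70) : fm_scope.
Notation "X =ₖ Y" := (f_ceq X Y) (at level 70) : fm_scope.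
Notation "x ∈ₛ y" := (f_sin x y) (at level 70) : fm_scope.
Notation "x ∈ₖ Y" := (f_cin x Y) (at level 70) : fm_scope.
Notation "¬ p" := (f_neg p) (at level 75, right associativity) : fm_scope.
Notation "p ∧ q" := (f_and p q) (at level 80, right associativity) : fm_scope.
Notation "p ∨ q" := (f_or p q) (at level 85, right associativity) : fm_scope.
Notation "p ⇒ q" := (f_imp p q) (at level 90, right associativity) : fm_scope.
Notation "p ⇔ q" := (f_iff p q) (at level 95, no associativity) : fm_scope.
Notation "∀ₛ x .. y , p" := (f_sall (fun x => .. (f_sall (fun y => p%fm)) ..))
  (at level 200, x binder, y binder, right associativity) : fm_scope.
Notation "∃ₛ x .. y , p" := (f_sex (fun x => .. (f_sex (fun y => p%fm)) ..))
  (at level 200, x binder, y binder, right associativity) : fm_scope.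
Notation "∀ₖ X .. Y , p" := (f_call (fun X => .. (f_call (fun Y => p%fm)) ..))
  (at level 200, X binder, Y binder, right associativity) : fm_scope.
Notation "∃ₖ X .. Y , p" := (f_cex (fun X => .. (f_cex (fun Y => p%fm)) ..))
  (at level 200, X binder, Y binder, right associativity) : fm_scope.

Local Open Scope fm_scope.

(** * Set-theoretic vocabulary *)

Definition is_empty (x : svar) : fm := ∀ₛ z, ¬ z ∈ₛ x.

Definition is_succ (s x : svar) : fm := ∀ₛ z, z ∈ₛ s ⇔ z ∈ₛ x ∨ z =ₛ x.

Definition inductive (w : svar) : fm :=
  (∃ₛ e, is_empty e ∧ e ∈ₛ w) ∧
  (∀ₛ x, x ∈ₛ w ⇒ ∃ₛ s, is_succ s x ∧ s ∈ₛ w).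

Definition is_omega (w : svar) : fm :=
  inductive w ∧ ∀ₛ v, inductive v ⇒ ∀ₛ x, x ∈ₛ w ⇒ x ∈ₛ v.

Definition in_omega (n : svar) : fm := ∃ₛ w, is_omega w ∧ n ∈ₛ w.

Definition is_upair (p x y : svar) : fm := ∀ₛ z, z ∈ₛ p ⇔ z =ₛ x ∨ z =ₛ y.

(** [p = {{x}, {x, y}}] *)
Definition is_pair (p x y : svar) : fm :=
  ∃ₛ u v, is_upair u x x ∧ is_upair v x y ∧ is_upair p u v.

Definition pair_in (x y f : svar) : fm := ∃ₛ p, is_pair p x y ∧ p ∈ₛ f.
Definition pair_inC (x y : svar) (F : cvar) : fm :=
  ∃ₛ p, is_pair p x y ∧ p ∈ₖ F.

Definition single_valued (F : cvar) : fm :=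
  ∀ₛ x y z, pair_inC x y F ∧ pair_inC x z F ⇒ y =ₛ z.

(** [f] is a set function from the set [d] to the class [X]. *)
Definition is_fun (f d : svar) (X : cvar) : fm :=
  (∀ₛ p, p ∈ₛ f ⇒ ∃ₛ k x, is_pair p k x ∧ k ∈ₛ d ∧ x ∈ₖ X) ∧
  (∀ₛ k, k ∈ₛ d ⇒ ∃ₛ x, pair_in k x f ∧ ∀ₛ y, pair_in k y f ⇒ y =ₛ x).

(** [r] is the restriction of [f] to [n]. *)
Definition is_restr (r f n : svar) : fm :=
  ∀ₛ p, p ∈ₛ r ⇔ (p ∈ₛ f ∧ ∃ₛ k y, k ∈ₛ n ∧ is_pair p k y).

(** * The theories *)

Definition set_extensionality : form := sentence
  (∀ₛ x y, (∀ₛ z, z ∈ₛ x ⇔ z ∈ₛ y) ⇒ x =ₛ y).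

Definition class_extensionality : form := sentence
  (∀ₖ X Y, (∀ₛ z, z ∈ₖ X ⇔ z ∈ₖ Y) ⇒ X =ₖ Y).

Definition pairing : form := sentence
  (∀ₛ x y, ∃ₛ p, is_upair p x y).

Definition union : form := sentence
  (∀ₛ x, ∃ₛ u, ∀ₛ z, z ∈ₛ u ⇔ ∃ₛ y, z ∈ₛ y ∧ y ∈ₛ x).

Definition power_set : form := sentence
  (∀ₛ x, ∃ₛ u, ∀ₛ z, z ∈ₛ u ⇔ ∀ₛ y, y ∈ₛ z ⇒ y ∈ₛ x).

Definition infinity : form := sentence (∃ₛ w, inductive w).

Definition foundation : form := sentence
  (∀ₖ C, (∃ₛ x, x ∈ₖ C) ⇒ ∃ₛ x, x ∈ₖ C ∧ ∀ₛ y, y ∈ₛ x ⇒ ¬ y ∈ₖ C).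

Definition replacement : form := sentence
  (∀ₖ F, single_valued F ⇒
    ∀ₛ a, ∃ₛ b, ∀ₛ y, y ∈ₛ b ⇔ ∃ₛ x, x ∈ₛ a ∧ pair_inC x y F).

Definition global_choice : form := sentence
  (∃ₖ F, single_valued F ∧
    ∀ₛ x, ¬ is_empty x ⇒ ∃ₛ y, y ∈ₛ x ∧ pair_inC x y F).

Definition base_axioms : list form :=
  [ set_extensionality; class_extensionality; pairing; union; power_set;
    infinity; foundation; replacement; global_choice ].

(** Existence of [{x | p}], universally closed in [k] set parameters and [l]
    class parameters.  In [p] the set variable [0] stands for [x]; under the
    new class quantifier the class parameters of [p] are shifted. *)
Definition comprehension (k l : nat) (p : form) : form :=
  Nat.iter k SAll (Nat.iter l CAll
    (CEx (SAll (Iff (CIn 0 0) (cshift p))))).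

(** Only set quantifiers; class variables may occur free. *)
Fixpoint first_order (p : form) : Prop :=
  match p with
  | Imp p q => first_order p /\ first_order q
  | SAll p => first_order p
  | CAll _ => False
  | _ => True
  end.

Inductive GBC : form -> Prop :=
| GBC_base p : In p base_axioms -> GBC p
| GBC_comprehension k l p :
    first_order p -> bounded (S k) l p -> GBC (comprehension k l p).

(** The formulas [CAll p] are the Π¹₁ formulas φ(x, Z): set variable [0] is
    [x], and the class variable [0] of [CAll p] is [Z]. *)
Inductive Pi11_comprehension : form -> Prop :=
| Pi11_instance p :
    first_order p -> bounded 1 1 (CAll p) ->
    Pi11_comprehension (comprehension 0 1 (CAll p)).

Definition GBC_Pi11 (p : form) : Prop := GBC p \/ Pi11_comprehension p.

Inductive KM : form -> Prop :=
| KM_base p : In p base_axioms -> KM p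
| KM_comprehension k l p : bounded (S k) l p -> KM (comprehension k l p).

Fact GBC_Pi11_subtheory_KM (p : form) : GBC_Pi11 p -> KM p.
Proof.
  intros [[q H | k l q _ H] | [q _ H]];
    [now apply KM_base | now apply KM_comprehension | now apply KM_comprehension].
Qed.

(** * Open determinacy for class games *)

Inductive player : Type := I | II.

Definition is_play (X : cvar) (f : svar) : fm := ∃ₛ w, is_omega w ∧ is_fun f w X.

Definition is_position (X : cvar) (s : svar) : fm :=
  ∃ₛ n, in_omega n ∧ is_fun s n X.

Definition is_strategy (X T : cvar) : fm :=
  (∀ₛ p, p ∈ₖ T ⇒ ∃ₛ s x, is_pair p s x ∧ is_position X s ∧ x ∈ₖ X) ∧
  (∀ₛ s, is_position X s ⇒
     ∃ₛ x, pair_inC s x T ∧ ∀ₛ y, pair_inC s y T ⇒ y =ₛ x).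

(** For [n] in ω, a set [E] as below contains exactly the even numbers among
    the elements of ω. *)
Definition is_even (n : svar) : fm :=
  ∃ₛ E, n ∈ₛ E ∧ (∃ₛ e, is_empty e ∧ e ∈ₛ E) ∧
    ∀ₛ k s, in_omega k ∧ is_succ s k ⇒ (s ∈ₛ E ⇔ ¬ k ∈ₛ E).

(** Player [I] chooses the entries of even index, in particular the first. *)
Definition to_move (i : player) (n : svar) : fm :=
  match i with I => is_even n | II => ¬ is_even n end.

(** [A] is the winning class of [I], and its complement that of [II]. *)
Definition won_by (i : player) (A : cvar) (f : svar) : fm :=
  match i with I => f ∈ₖ A | II => ¬ f ∈ₖ A end.

Definition follows (i : player) (T : cvar) (f : svar) : fm :=
  ∀ₛ n, in_omega n ⇒ to_move i n ⇒
    ∃ₛ r x, is_restr r f n ∧ pair_in n x f ∧ pair_inC r x T.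

Definition is_winning_strategy (i : player) (X A T : cvar) : fm :=
  is_strategy X T ∧ ∀ₛ f, is_play X f ⇒ follows i T f ⇒ won_by i A f.

(** The plays extending a given finite sequence form a base of the product
    topology. *)
Definition is_open_for (i : player) (X A : cvar) : fm :=
  ∀ₛ f, is_play X f ∧ won_by i A f ⇒
    ∃ₛ n r, in_omega n ∧ is_restr r f n ∧
      ∀ₛ g, is_play X g ∧ is_restr r g n ⇒ won_by i A g.

(** [X] is nonempty, as otherwise there is no function from its finite
    sequences to [X]. *)
Definition open_determinacy : form := sentence
  (∀ₖ X A,
     (∃ₛ x, x ∈ₖ X) ∧ (∀ₛ f, f ∈ₖ A ⇒ is_play X f) ∧
     (is_open_for I X A ∨ is_open_for II X A) ⇒
       (∃ₖ T, is_winning_strategy I X A T) ∨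
       (∃ₖ T, is_winning_strategy II X A T)).

(* Main.v *)
(** By Henkin completeness it suffices to argue in an arbitrary model of GBC with Π¹₁-comprehension.
    The positions won by the open player form the least fixed point of a monotone operator.  Comparing
    the ordinal ranks of two positions in this fixed point is itself a least fixed point (the stage
    comparison of Moschovakis), so that a single instance of Π¹₁-comprehension yields a class relation
    playing the part of the ranks, and neither class ordinals nor a choice of classes is needed.  A move
    decreasing the rank is a winning strategy inside the fixed point, and a move avoiding the fixed
    point is one outside of it.  Moves are chosen from classes by global choice and Scott's trick, for
    which set ranks are again compared by a least fixed point. *)

From Stdlib Require Import List Arith Lia Classical ClassicalEpsilon FunctionalExtensionality
  PropExtensionality Cantor.
Require Import Defs.
Import ListNotations.
Set Implicit Arguments.

(** * Renaming *)

(** A least fixed point is the intersection of all classes closed under the operator: one universal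
    class quantifier over a first-order matrix. The fixed point alone gives no strategy, since a
    player who merely stays inside it may never reach a won position; the moves have to descend.
    Ordinal ranks that would measure the descent may run past all set ordinals, so they cannot be
    values of a class function. Write Γ for the operator. The relation [p] ≤ [q] ([p] enters no
    later than [q]) satisfies: [p] ≤ [q] iff [p] ∈ Γ{b | b < q}, and b < q iff [q] ∉ Γ{b' | not b ≤
    b'}. Substituting the second into the first leaves a recursion in ≤ alone, where ≤ occurs under
    two negations, hence positively. Its least solution is [R]. Set ranks need the same treatment,
    so Γ is abstracted to [gam kappa]. All other comprehension is first-order. Induction and
    minimality are therefore stated only for predicates satisfying [Def]; [R], once it is a class,
    may occur in them as a parameter. *)

Lemma ren_bounded_ext p : forall n m f g f' g', bounded n m p ->
  (forall i, i < n -> f i = f' i) -> (forall i, i < m -> g i = g' i) ->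
  ren f g p = ren f' g' p.
Proof.
  induction p; cbn; intros n m f g f' g' B Hf Hg;
    repeat match goal with H : _ /\ _ |- _ => destruct H end; f_equal; eauto.
  - eapply IHp; eauto. intros [|i] Hi; cbn; auto. rewrite Hf; auto; lia.
  - eapply IHp; eauto. intros [|i] Hi; cbn; auto. rewrite Hg; auto; lia.
Qed.

Lemma ren_ext p f g f' g' : (forall i, f i = f' i) -> (forall i, g i = g' i) ->
  ren f g p = ren f' g' p.
Proof.
  intros Hf Hg. replace f' with f by now apply functional_extensionality.
  replace g' with g by now apply functional_extensionality. reflexivity.
Qed.

Lemma ren_comp p : forall f g f' g',
  ren f g (ren f' g' p) = ren (fun i => f (f' i)) (fun i => g (g' i)) p.
Proof.
  induction p; cbn; intros; f_equal; auto.
  - rewrite IHp. apply ren_ext; auto. now intros [|i].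
  - rewrite IHp. apply ren_ext; auto. now intros [|i].
Qed.

Lemma ren_nid p : ren nid nid p = p.
Proof.
  assert (U : up nid = nid) by (apply functional_extensionality; now intros [|i]).
  induction p; cbn; rewrite ?U; unfold nid in *; congruence.
Qed.

Lemma bounded_mono p : forall n m n' m', bounded n m p -> n <= n' -> m <= m' ->
  bounded n' m' p.
Proof.
  induction p; cbn; intros n m n' m' B Hn Hm;
    repeat match goal with H : _ /\ _ |- _ => destruct H end;
    repeat split; try lia; eauto.
  all: eapply IHp; eauto; lia.
Qed.

Fixpoint var_bound (p : form) : nat :=
  match p with
  | Bot => 0
  | SEq x y | CEq x y | SIn x y | CIn x y => S (x + y)
  | Imp p q => var_bound p + var_bound q
  | SAll p | CAll p => var_bound p
  end.

Lemma bounded_var_bound p : bounded (var_bound p) (var_bound p) p.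
Proof.
  induction p; cbn; repeat split; try lia; eapply bounded_mono; eauto; lia.
Qed.

Lemma ren_sentence p f g : bounded 0 0 p -> ren f g p = p.
Proof.
  intros B. rewrite <- (ren_nid p) at 2.
  eapply ren_bounded_ext; eauto; intros; lia.
Qed.

(** * Derivations *)

Definition sentences (T : form -> Prop) : Prop := forall p, T p -> bounded 0 0 p.

(** Axioms survive the renaming because a sentence is fixed by every renaming. *)
Lemma prv_ren T (HT : sentences T) G p : prv T G p ->
  forall f g, prv T (map (ren f g) G) (ren f g p).
Proof.
  induction 1; intros f g; cbn in *.
  - rewrite ren_sentence by auto. now apply prv_ax.
  - apply prv_hyp. now apply in_map.
  - apply prv_impI, IHprv.
  - eapply prv_impE; [apply IHprv1 | apply IHprv2].
  - apply prv_dne, IHprv.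
  - apply prv_sallI. rewrite map_map. specialize (IHprv (up f) g).
    rewrite map_map in IHprv. erewrite map_ext; [exact IHprv|].
    intros a. unfold sshift. rewrite !ren_comp. now apply ren_ext.
  - replace (ren f g (sinst p x)) with (sinst (ren (up f) g p) (f x)).
    + now apply prv_sallE, IHprv.
    + unfold sinst. rewrite !ren_comp. apply ren_ext; auto. now intros [|i].
  - apply prv_callI. rewrite map_map. specialize (IHprv f (up g)).
    rewrite map_map in IHprv. erewrite map_ext; [exact IHprv|].
    intros a. unfold cshift. rewrite !ren_comp. now apply ren_ext.
  - replace (ren f g (cinst p X)) with (cinst (ren f (up g) p) (g X)).
    + now apply prv_callE, IHprv.
    + unfold cinst. rewrite !ren_comp. apply ren_ext; auto. now intros [|i].
  - apply prv_srefl.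
  - replace (ren f g (sinst p y)) with (sinst (ren (up f) g p) (f y)).
    + eapply prv_srepl; [apply IHprv1|].
      replace (sinst (ren (up f) g p) (f x)) with (ren f g (sinst p x)); [apply IHprv2|].
      unfold sinst. rewrite !ren_comp. apply ren_ext; auto. now intros [|i].
    + unfold sinst. rewrite !ren_comp. apply ren_ext; auto. now intros [|i].
  - apply prv_crefl.
  - replace (ren f g (cinst p Y)) with (cinst (ren f (up g) p) (g Y)).
    + eapply prv_crepl; [apply IHprv1|].
      replace (cinst (ren f (up g) p) (g X)) with (ren f g (cinst p X)); [apply IHprv2|].
      unfold cinst. rewrite !ren_comp. apply ren_ext; auto. now intros [|i].
    + unfold cinst. rewrite !ren_comp. apply ren_ext; auto. now intros [|i].
Qed.

Lemma prv_weaken T G p : prv T G p -> forall G', incl G G' -> prv T G' p.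
Proof.
  induction 1; intros G' HG;
    try (econstructor; solve [eauto | apply IHprv; now apply incl_map]).
  apply prv_impI, IHprv. intros a [<-|Ha]; cbn; auto.
Qed.

Lemma prv_mono (T T' : form -> Prop) (HT : forall p, T p -> T' p) G p :
  prv T G p -> prv T' G p.
Proof. induction 1; eauto using prv. Qed.

Lemma prv_exfalso T G p : prv T G Bot -> prv T G p.
Proof.
  intros H. apply prv_dne, prv_impI. eapply prv_weaken; eauto. apply incl_tl, incl_refl.
Qed.

(** The renaming that sends [y] to 0 and every other variable to its successor agrees with the shift
    below [y], so it turns the given derivation into the premise of [prv_sallI]. *)
Lemma prv_sall_fresh T (HT : sentences T) G q y :
  (forall p, In p G -> bounded y y p) -> bounded (S y) y q ->
  prv T G (sinst q y) -> prv T G (SAll q).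
Proof.
  intros HG Hq H. apply prv_sallI.
  pose proof (prv_ren HT H (fun n => if n =? y then 0 else S n) nid) as K.
  assert (E : forall i, i < y -> (if i =? y then 0 else S i) = S i).
  { intros i Hi. destruct (Nat.eqb_spec i y); [lia|auto]. }
  replace (map sshift G) with
    (map (ren (fun n => if n =? y then 0 else S n) nid) G).
  - match type of K with prv _ _ ?a => replace a with q in K; [exact K|] end.
    unfold sinst. rewrite ren_comp, <- (ren_nid q) at 1.
    eapply ren_bounded_ext; eauto.
    intros [|i] Hi; cbn; [now rewrite Nat.eqb_refl|]. unfold nid. rewrite E; lia.
  - apply map_ext_in. intros a Ha. eapply ren_bounded_ext; eauto.
Qed.

Lemma prv_call_fresh T (HT : sentences T) G q y :
  (forall p, In p G -> bounded y y p) -> bounded y (S y) q ->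
  prv T G (cinst q y) -> prv T G (CAll q).
Proof.
  intros HG Hq H. apply prv_callI.
  pose proof (prv_ren HT H nid (fun n => if n =? y then 0 else S n)) as K.
  assert (E : forall i, i < y -> (if i =? y then 0 else S i) = S i).
  { intros i Hi. destruct (Nat.eqb_spec i y); [lia|auto]. }
  replace (map cshift G) with
    (map (ren nid (fun n => if n =? y then 0 else S n)) G).
  - match type of K with prv _ _ ?a => replace a with q in K; [exact K|] end.
    unfold cinst. rewrite ren_comp, <- (ren_nid q) at 1.
    eapply ren_bounded_ext; eauto.
    intros [|i] Hi; cbn; [now rewrite Nat.eqb_refl|]. unfold nid. rewrite E; lia.
  - apply map_ext_in. intros a Ha. eapply ren_bounded_ext; eauto.
Qed.

(** * Structures and completeness *)

Record structure : Type := Structure {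
  sets : Type;
  classes : Type;
  sin : sets -> sets -> Prop;
  cin : sets -> classes -> Prop }.

Definition cons_env (A : Type) (x : A) (r : nat -> A) (n : nat) : A :=
  match n with 0 => x | S k => r k end.

Fixpoint sat (M : structure) (r : nat -> sets M) (s : nat -> classes M) (p : form) : Prop :=
  match p with
  | Bot => False
  | SEq x y => r x = r y
  | CEq X Y => s X = s Y
  | SIn x y => sin M (r x) (r y)
  | CIn x Y => cin M (r x) (s Y)
  | Imp p q => sat M r s p -> sat M r s q
  | SAll p => forall x, sat M (cons_env x r) s p
  | CAll p => forall X, sat M r (cons_env X s) p
  end.

Lemma sat_ren M p : forall r s f g,
  sat M r s (ren f g p) <-> sat M (fun i => r (f i)) (fun i => s (g i)) p.
Proof.
  induction p; cbn; intros r s f g; try tauto.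
  - rewrite IHp1, IHp2. tauto.
  - split; intros H x; specialize (H x); rewrite IHp in *;
      match type of H with sat _ ?a _ _ => match goal with |- sat _ ?b _ _ =>
        replace b with a; [exact H|] end end;
      apply functional_extensionality; now intros [|i].
  - split; intros H x; specialize (H x); rewrite IHp in *;
      match type of H with sat _ _ ?a _ => match goal with |- sat _ _ ?b _ =>
        replace b with a; [exact H|] end end;
      apply functional_extensionality; now intros [|i].
Qed.

Fixpoint decode (fuel n : nat) : form :=
  match fuel with
  | 0 => Bot
  | S k =>
    let (c, m) := of_nat n in
    let (a, b) := of_nat m in
    match c with
    | 0 => SEq a b
    | 1 => CEq a b
    | 2 => SIn a b
    | 3 => CIn a b
    | 4 => Imp (decode k a) (decode k b)
    | 5 => SAll (decode k a)
    | 6 => CAll (decode k a)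
    | _ => Bot
    end
  end.

Definition enum (n : nat) : form := let (k, m) := of_nat n in decode k m.

(** All large fuels are claimed, not just one, because both sides of an implication are decoded with
    the same fuel. The tag 7 used for [Bot] is simply one that names no other constructor. *)
Lemma decode_onto p : exists k, forall k', k <= k' -> exists n, decode k' n = p.
Proof.
  assert (A : forall c m q, (forall k, decode (S k) (to_nat (c, m)) = q) ->
    exists k, forall k', k <= k' -> exists n, decode k' n = q).
  { intros c m q H. exists 1. intros [|k'] Hk'; [lia|]. eauto. }
  induction p as [|x y|X Y|x y|x Y|p [k Hk] q [l Hl]|p [k Hk]|p [k Hk]].
  1: apply (A 7 0). 2: apply (A 0 (to_nat (x, y))). 3: apply (A 1 (to_nat (X, Y))).
  4: apply (A 2 (to_nat (x, y))). 5: apply (A 3 (to_nat (x, Y))).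
  1-5: intros k; cbn [decode]; now rewrite !cancel_of_to.
  - exists (S (max k l)). intros [|k'] Hk'; [lia|].
    destruct (Hk k') as [n Hn]; [lia|]. destruct (Hl k') as [m Hm]; [lia|].
    exists (to_nat (4, to_nat (n, m))). cbn [decode]. rewrite !cancel_of_to. congruence.
  - exists (S k). intros [|k'] Hk'; [lia|]. destruct (Hk k') as [n Hn]; [lia|].
    exists (to_nat (5, to_nat (n, 0))). cbn [decode]. rewrite !cancel_of_to. congruence.
  - exists (S k). intros [|k'] Hk'; [lia|]. destruct (Hk k') as [n Hn]; [lia|].
    exists (to_nat (6, to_nat (n, 0))). cbn [decode]. rewrite !cancel_of_to. congruence.
Qed.

Lemma enum_onto p : exists n, enum n = p.
Proof.
  destruct (decode_onto p) as [k Hk]. destruct (Hk k) as [n Hn]; auto.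
  exists (to_nat (k, n)). unfold enum. now rewrite cancel_of_to.
Qed.

(** * Henkin's construction of a term model *)

Section Henkin.

Context (T : form -> Prop) (HT : sentences T) (G0 : list form)
  (G0_consistent : ~ prv T G0 Bot).

Definition fresh (G : list form) : nat := list_sum (map var_bound G).

Lemma fresh_spec G p : In p G -> bounded (fresh G) (fresh G) p.
Proof.
  intros Hp. assert (var_bound p <= fresh G).
  { unfold fresh, list_sum. induction G as [|q G IH]; cbn in *; [tauto|].
    destruct Hp as [->|Hp]; [lia|]. specialize (IH Hp). lia. }
  eapply bounded_mono; eauto using bounded_var_bound.
Qed.

(** Variables serve as Henkin constants: every stage is a finite list of formulas, so a fresh index
    always remains. *)
Definition witness (y : nat) (p : form) : list form :=
  match p with
  | Imp (SAll q) Bot => [Neg (sinst q y)]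
  | Imp (CAll q) Bot => [Neg (cinst q y)]
  | _ => []
  end.

Definition henkin_step (G : list form) (p : form) : list form :=
  if excluded_middle_informative (prv T (p :: G) Bot) then G
  else witness (fresh (p :: G)) p ++ p :: G.

Fixpoint stage (n : nat) : list form :=
  match n with 0 => G0 | S k => henkin_step (stage k) (enum k) end.

Definition hth (p : form) : Prop := exists n, prv T (stage n) p.

Lemma henkin_step_consistent G p : ~ prv T G Bot -> ~ prv T (henkin_step G p) Bot.
Proof.
  unfold henkin_step. destruct (excluded_middle_informative _) as [|C]; auto.
  intros _ H. set (y := fresh (p :: G)) in *.
  destruct p as [| | | | |[| | | | | |q|q] [| | | | | | |]| |]; cbn in H; auto.
  - apply C. eapply prv_impE; [now apply prv_hyp; left|].
    apply prv_sall_fresh with (y := y); auto.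
    + apply fresh_spec.
    + apply (@fresh_spec (Neg (SAll q) :: G) (Neg (SAll q))). now left.
    + now apply prv_dne, prv_impI.
  - apply C. eapply prv_impE; [now apply prv_hyp; left|].
    apply prv_call_fresh with (y := y); auto.
    + apply fresh_spec.
    + apply (@fresh_spec (Neg (CAll q) :: G) (Neg (CAll q))). now left.
    + now apply prv_dne, prv_impI.
Qed.

Lemma stage_consistent n : ~ prv T (stage n) Bot.
Proof. induction n; cbn; auto using henkin_step_consistent. Qed.

Lemma stage_mono n m : n <= m -> incl (stage n) (stage m).
Proof.
  induction 1; [apply incl_refl|]. eapply incl_tran; eauto. cbn.
  unfold henkin_step. destruct (excluded_middle_informative _); [apply incl_refl|].
  now apply incl_appr, incl_tl, incl_refl.
Qed.

Lemma hth_join p q : hth p -> hth q -> exists n, prv T (stage n) p /\ prv T (stage n) q.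
Proof.
  intros [n Hn] [m Hm]. exists (max n m).
  split; eapply prv_weaken; eauto; apply stage_mono; lia.
Qed.

Lemma hth_mp p q : hth (Imp p q) -> hth p -> hth q.
Proof.
  intros Hpq Hp. destruct (hth_join Hpq Hp) as [n [H1 H2]]. exists n. now eapply prv_impE; eauto.
Qed.

Lemma hth_bot : ~ hth Bot.
Proof. intros [n H]. now apply (stage_consistent n). Qed.

Lemma stage_enum n : ~ prv T (enum n :: stage n) Bot ->
  forall a, In a (witness (fresh (enum n :: stage n)) (enum n) ++ enum n :: stage n) ->
  hth a.
Proof.
  intros C a Ha. exists (S n). apply prv_hyp. cbn. unfold henkin_step.
  now destruct (excluded_middle_informative _).
Qed.

Lemma hth_total p : hth p \/ hth (Neg p).
Proof.
  destruct (enum_onto p) as [n <-].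
  destruct (classic (prv T (enum n :: stage n) Bot)) as [C|C].
  - right. exists n. now apply prv_impI.
  - left. apply (stage_enum n C). apply in_or_app. right. now left.
Qed.

Lemma hth_imp p q : hth (Imp p q) <-> (hth p -> hth q).
Proof.
  split; [apply hth_mp|]. intros H.
  destruct (hth_total p) as [Hp|[n Hn]].
  - destruct (H Hp) as [n Hn]. exists n. apply prv_impI.
    eapply prv_weaken; eauto. apply incl_tl, incl_refl.
  - exists n. apply prv_impI, prv_exfalso.
    eapply prv_impE; [|now apply prv_hyp; left].
    eapply prv_weaken; eauto. apply incl_tl, incl_refl.
Qed.

(** Had [p] been rejected when it was enumerated, a later stage proving [p] would be inconsistent.
    So [p] was added, together with its witness. *)
Lemma hth_witness p : hth p ->
  exists y, forall a, In a (witness y p) -> hth a.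
Proof.
  intros Hp. destruct (enum_onto p) as [n <-].
  exists (fresh (enum n :: stage n)). intros a Ha.
  apply (stage_enum n); [|now apply in_or_app; left].
  intros C. destruct Hp as [m Hm].
  apply (stage_consistent (max n m)).
  apply prv_impE with (enum n).
  - apply prv_impI. apply (prv_weaken C).
    intros b [<-|Hb]; [now left|]. right. apply (@stage_mono n (max n m)); auto; lia.
  - apply (prv_weaken Hm). apply stage_mono; lia.
Qed.

Lemma hth_sall q : hth (SAll q) <-> forall x, hth (sinst q x).
Proof.
  split.
  - intros [n Hn] x. exists n. now apply prv_sallE.
  - intros H. destruct (hth_total (SAll q)) as [|N]; auto.
    destruct (hth_witness N) as [y Hy]. exfalso. apply hth_bot.
    apply hth_mp with (sinst q y); auto. apply Hy. now left.
Qed.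

Lemma hth_call q : hth (CAll q) <-> forall x, hth (cinst q x).
Proof.
  split.
  - intros [n Hn] x. exists n. now apply prv_callE.
  - intros H. destruct (hth_total (CAll q)) as [|N]; auto.
    destruct (hth_witness N) as [y Hy]. exfalso. apply hth_bot.
    apply hth_mp with (cinst q y); auto. apply Hy. now left.
Qed.

Lemma hth_srepl p x y : hth (SEq x y) -> hth (sinst p x) -> hth (sinst p y).
Proof.
  intros H1 H2. destruct (hth_join H1 H2) as [n [K1 K2]]. exists n. eapply prv_srepl; eauto.
Qed.

Lemma hth_crepl p x y : hth (CEq x y) -> hth (cinst p x) -> hth (cinst p y).
Proof.
  intros H1 H2. destruct (hth_join H1 H2) as [n [K1 K2]]. exists n. eapply prv_crepl; eauto.
Qed.

Lemma hth_srefl x : hth (SEq x x).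
Proof. exists 0. apply prv_srefl. Qed.

Lemma hth_crefl x : hth (CEq x x).
Proof. exists 0. apply prv_crefl. Qed.

(** The quotient by provable equality is formed by representatives, so that equality in the model is
    genuine equality. Provably equal variables define the same predicate, hence [epsilon] returns
    the same representative. *)
Definition srep (x : nat) : nat := epsilon (inhabits 0) (fun y => hth (SEq x y)).
Definition crep (x : nat) : nat := epsilon (inhabits 0) (fun y => hth (CEq x y)).

Lemma srep_spec x : hth (SEq x (srep x)).
Proof.
  apply (epsilon_spec (inhabits 0) (fun y => hth (SEq x y))). eauto using hth_srefl.
Qed.

Lemma crep_spec x : hth (CEq x (crep x)).
Proof.
  apply (epsilon_spec (inhabits 0) (fun y => hth (CEq x y))). eauto using hth_crefl.
Qed.

Lemma srep_eq x y : hth (SEq x y) <-> srep x = srep y.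
Proof.
  assert (Sym : forall x y, hth (SEq x y) -> hth (SEq y x)).
  { intros a b H. apply (hth_srepl (SEq 0 (S a)) H), hth_srefl. }
  assert (Tr : forall x y z, hth (SEq x y) -> hth (SEq y z) -> hth (SEq x z)).
  { intros a b c H K. exact (hth_srepl (SEq (S a) 0) K H). }
  split.
  - intros H. unfold srep. f_equal. apply functional_extensionality. intros z.
    apply propositional_extensionality. split; eauto.
  - intros E. apply Tr with (srep x); [apply srep_spec|]. rewrite E. apply Sym, srep_spec.
Qed.

Lemma crep_eq x y : hth (CEq x y) <-> crep x = crep y.
Proof.
  assert (Sym : forall x y, hth (CEq x y) -> hth (CEq y x)).
  { intros a b H. apply (hth_crepl (CEq 0 (S a)) H), hth_crefl. }
  assert (Tr : forall x y z, hth (CEq x y) -> hth (CEq y z) -> hth (CEq x z)).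
  { intros a b c H K. exact (hth_crepl (CEq (S a) 0) K H). }
  split.
  - intros H. unfold crep. f_equal. apply functional_extensionality. intros z.
    apply propositional_extensionality. split; eauto.
  - intros E. apply Tr with (crep x); [apply crep_spec|]. rewrite E. apply Sym, crep_spec.
Qed.

Definition hmodel : structure := {|
  sets := {x | srep x = x};
  classes := {X | crep X = X};
  sin x y := hth (SIn (proj1_sig x) (proj1_sig y));
  cin x Y := hth (CIn (proj1_sig x) (proj1_sig Y)) |}.

Definition to_set (x : nat) : sets hmodel :=
  exist _ (srep x) (eq_sym (proj1 (srep_eq x (srep x)) (srep_spec x))).
Definition to_class (x : nat) : classes hmodel :=
  exist _ (crep x) (eq_sym (proj1 (crep_eq x (crep x)) (crep_spec x))).

Lemma hmodel_sat p : forall (r : nat -> sets hmodel) (s : nat -> classes hmodel),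
  sat hmodel r s p <->
  hth (ren (fun i => proj1_sig (r i)) (fun i => proj1_sig (s i)) p).
Proof.
  induction p; intros r s; cbn.
  - split; [tauto|apply hth_bot].
  - rewrite srep_eq. destruct (r x) as [a Ha], (r y) as [b Hb]; cbn. split.
    + intros E. injection E as ->. reflexivity.
    + intros E. assert (a = b) by congruence. subst b. f_equal. apply proof_irrelevance.
  - rewrite crep_eq. destruct (s X) as [a Ha], (s Y) as [b Hb]; cbn. split.
    + intros E. injection E as ->. reflexivity.
    + intros E. assert (a = b) by congruence. subst b. f_equal. apply proof_irrelevance.
  - tauto.
  - tauto.
  - rewrite IHp1, IHp2, hth_imp. tauto.
  - assert (E : forall x, ren (fun i => proj1_sig (cons_env x r i)) (fun i => proj1_sig (s i)) p =
      sinst (ren (up (fun i => proj1_sig (r i))) (fun i => proj1_sig (s i)) p) (proj1_sig x)).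
    { intros x. unfold sinst. rewrite ren_comp. apply ren_ext; auto. now intros [|i]. }
    rewrite hth_sall. split; intros H x.
    + specialize (H (to_set x)). rewrite IHp, E in H.
      refine (hth_srepl _ _ H). apply srep_eq. cbn. symmetry. apply srep_eq, srep_spec.
    + rewrite IHp, E. apply H.
  - assert (E : forall x, ren (fun i => proj1_sig (r i)) (fun i => proj1_sig (cons_env x s i)) p =
      cinst (ren (fun i => proj1_sig (r i)) (up (fun i => proj1_sig (s i))) p) (proj1_sig x)).
    { intros x. unfold cinst. rewrite ren_comp. apply ren_ext; auto. now intros [|i]. }
    rewrite hth_call. split; intros H x.
    + specialize (H (to_class x)). rewrite IHp, E in H.
      refine (hth_crepl _ _ H). apply crep_eq. cbn. symmetry. apply crep_eq, crep_spec.
    + rewrite IHp, E. apply H.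
Qed.

End Henkin.

Definition models (T : form -> Prop) (M : structure) : Prop :=
  forall p, T p -> forall r s, sat M r s p.

Theorem completeness T p : sentences T -> bounded 0 0 p ->
  (forall M, models T M -> forall r s, sat M r s p) -> proves T p.
Proof.
  intros HT Hp H. apply prv_dne, prv_impI. apply NNPP. intros C.
  set (G := [Neg p]) in C.
  assert (K : sat (hmodel T G) (fun _ => to_set T G 0) (fun _ => to_class T G 0) p).
  { apply H. intros q Hq r s. apply (hmodel_sat HT C). exists 0.
    rewrite ren_sentence by auto. now apply prv_ax. }
  apply (hmodel_sat HT C) in K. rewrite ren_sentence in K by auto.
  apply (hth_bot HT C). apply hth_mp with p; auto.
  exists 0. apply prv_hyp. now left.
Qed.

(** * Reading formulas in a structure *)

(* [sat] with the encodings of conjunction and existence decoded, so that a concrete formula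
   computes to the proposition it stands for; a disjunction remains the implication [~ p -> q]. *)
Fixpoint rsat (M : structure) (r : nat -> sets M) (s : nat -> classes M) (p : form) : Prop :=
  match p with
  | Bot => False
  | SEq x y => r x = r y
  | CEq X Y => s X = s Y
  | SIn x y => sin M (r x) (r y)
  | CIn x Y => cin M (r x) (s Y)
  | SAll p => forall x, rsat M (cons_env x r) s p
  | CAll p => forall X, rsat M r (cons_env X s) p
  | Imp p Bot =>
    match p with
    | SAll (Imp q Bot) => exists x, rsat M (cons_env x r) s q
    | CAll (Imp q Bot) => exists X, rsat M r (cons_env X s) q
    | Imp q (Imp t Bot) => rsat M r s q /\ rsat M r s t
    | _ => rsat M r s p -> False
    end
  | Imp p q => rsat M r s p -> rsat M r s q
  end.

Lemma not_all_not_iff (A : Type) (P Q : A -> Prop) : (forall x, Q x <-> P x) ->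
  ((exists x, Q x) <-> ((forall x, P x -> False) -> False)).
Proof.
  intros H. split.
  - intros [x Hx] K. now apply (K x), H.
  - intros K. apply NNPP. intros N. apply K. intros x Hx. apply N. exists x. now apply H.
Qed.

Lemma rsat_iff M p : forall r s, rsat M r s p <-> sat M r s p.
Proof.
  (* [rsat] looks several constructors deep, so the hypothesis is needed for subformulas that are
     not immediate ones. *)
  revert p. fix IH 1. intros p r s.
  destruct p as [| | | | |p q|p|p]; try (cbn; tauto).
  2: { cbn. split; intros H x; specialize (H x); apply IH in H; exact H. }
  2: { cbn. split; intros H x; specialize (H x); apply IH in H; exact H. }
  assert (I0 : (rsat M r s p -> rsat M r s q) <-> (sat M r s p -> sat M r s q)).
  { pose proof (IH p r s). pose proof (IH q r s). tauto. }
  destruct q; try exact I0.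
  destruct p as [| | | | |p q|p|p]; try exact I0.
  - destruct q as [| | | | |q t| |]; try exact I0.
    destruct t; only 2-8: exact I0. clear I0.
    pose proof (IH p r s). pose proof (IH q r s). cbn [rsat sat]. tauto.
  - destruct p as [| | | | |p q| |]; try exact I0.
    destruct q; only 2-8: exact I0.
    cbn [rsat sat]. apply not_all_not_iff. intros x. apply IH.
  - destruct p as [| | | | |p q| |]; try exact I0.
    destruct q; only 2-8: exact I0.
    cbn [rsat sat]. apply not_all_not_iff. intros x. apply IH.
Qed.

(** * First-order definability with class parameters *)

Section Definability.

Context (M : structure).

Notation V := (sets M).
Notation env := (nat -> sets M).

Definition Def (P : env -> Prop) : Prop :=
  exists p s, first_order p /\ forall r, sat M r s p <-> P r.

Definition DefT (t : env -> V) : Prop := Def (fun r => r 0 = t (fun i => r (S i))).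

Lemma Def_ext (P Q : env -> Prop) : (forall r, P r <-> Q r) -> Def P -> Def Q.
Proof.
  intros E (p & s & F & H). exists p, s. split; auto. intros r. rewrite H. apply E.
Qed.

Lemma first_order_ren p : forall f g, first_order p -> first_order (ren f g p).
Proof. induction p; cbn; intros; try tauto; auto. destruct H; auto. Qed.

Lemma Def_ren (f : nat -> nat) (P : env -> Prop) : Def P -> Def (fun r => P (fun i => r (f i))).
Proof.
  intros (p & s & F & H). exists (ren f nid p), s. split; [now apply first_order_ren|].
  intros r. rewrite sat_ren. apply H.
Qed.

Lemma Def_imp (P Q : env -> Prop) : Def P -> Def Q -> Def (fun r => P r -> Q r).
Proof.
  intros (p & s & F & H) (q & s' & F' & H').
  (* Each formula brings its own assignment of class parameters; the two are interleaved on even and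
     odd indices. *)
  exists (Imp (ren nid (fun i => 2 * i) p) (ren nid (fun i => S (2 * i)) q)),
    (fun i => if Nat.even i then s (i / 2) else s' (i / 2)).
  split; [cbn; auto using first_order_ren|].
  intros r. cbn [sat]. rewrite !sat_ren, <- H, <- H'.
  match goal with |- (sat _ _ ?a _ -> sat _ _ ?b _) <-> _ =>
    replace a with s; [replace b with s'; [reflexivity|]|] end;
    apply functional_extensionality; intros i.
  - rewrite Nat.even_succ, <- Nat.negb_even, Nat.even_mul.
    cbn [Nat.even orb negb]. f_equal. rewrite Nat.mul_comm.
    apply Nat.div_unique with 1; lia.
  - rewrite Nat.even_mul. cbn [Nat.even orb]. f_equal.
    rewrite Nat.mul_comm, Nat.div_mul; lia.
Qed.

Lemma Def_all (P : env -> V -> Prop) :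
  Def (fun r => P (fun i => r (S i)) (r 0)) -> Def (fun r => forall x, P r x).
Proof.
  intros (p & s & F & H). exists (SAll p), s. split; auto.
  intros r. cbn. split; intros K x; [apply (H (cons_env x r)), K|apply H, K].
Qed.

Context (s0 : nat -> classes M).

(** [Q] belongs to the metatheory and is decided there, so its complexity does not matter. *)
Lemma Def_const (Q : Prop) : Def (fun _ => Q).
Proof.
  destruct (classic Q).
  - exists (Imp Bot Bot), s0. cbn. tauto.
  - exists Bot, s0. cbn. tauto.
Qed.

Lemma Def_not (P : env -> Prop) : Def P -> Def (fun r => ~ P r).
Proof. intros. apply Def_imp; auto using Def_const. Qed.

Lemma Def_and (P Q : env -> Prop) : Def P -> Def Q -> Def (fun r => P r /\ Q r).
Proof.
  intros. apply Def_ext with (fun r => ~ (P r -> ~ Q r)).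
  - intros. tauto.
  - auto using Def_not, Def_imp.
Qed.

Lemma Def_or (P Q : env -> Prop) : Def P -> Def Q -> Def (fun r => P r \/ Q r).
Proof.
  intros. apply Def_ext with (fun r => ~ P r -> Q r).
  - intros. tauto.
  - auto using Def_not, Def_imp.
Qed.

Lemma Def_iff (P Q : env -> Prop) : Def P -> Def Q -> Def (fun r => P r <-> Q r).
Proof. intros. apply Def_and; auto using Def_imp. Qed.

Lemma Def_ex (P : env -> V -> Prop) :
  Def (fun r => P (fun i => r (S i)) (r 0)) -> Def (fun r => exists x, P r x).
Proof.
  intros H. apply Def_ext with (fun r => ~ forall x, ~ P r x).
  - intros r. split; [apply not_all_not_ex|]. intros [x Hx] K. now apply (K x).
  - apply Def_not, Def_all, Def_not, H.
Qed.

Lemma DefT_var i : DefT (fun r => r i).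
Proof. exists (SEq 0 (S i)), s0. cbn. tauto. Qed.

Lemma DefT_lift (t : env -> V) : DefT t -> DefT (fun r => t (fun i => r (S i))).
Proof. apply (Def_ren (fun i => match i with 0 => 0 | S k => S (S k) end)). Qed.

Lemma Def_app1 (P : V -> Prop) (t : env -> V) :
  Def (fun r => P (r 0)) -> DefT t -> Def (fun r => P (t r)).
Proof.
  intros HP Ht. apply Def_ext with (fun r => forall x, x = t r -> P x).
  - intros r. split; [auto|intros ? ? ->; auto].
  - apply Def_all, Def_imp; auto.
Qed.

Lemma Def_app2 (P : V -> V -> Prop) (t u : env -> V) :
  Def (fun r => P (r 0) (r 1)) -> DefT t -> DefT u -> Def (fun r => P (t r) (u r)).
Proof.
  intros HP Ht Hu.
  apply Def_ext with (fun r => forall x, x = t r -> forall y, y = u r -> P x y).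
  - intros r. split; [auto|intros ? ? -> ? ->; auto].
  - apply Def_all, Def_imp; auto. apply Def_all, Def_imp; [now apply DefT_lift|].
    apply (Def_ren (fun i => match i with 0 => 1 | _ => 0 end) HP).
Qed.

Lemma Def_app3 (P : V -> V -> V -> Prop) (t u v : env -> V) :
  Def (fun r => P (r 0) (r 1) (r 2)) -> DefT t -> DefT u -> DefT v ->
  Def (fun r => P (t r) (u r) (v r)).
Proof.
  intros HP Ht Hu Hv.
  apply Def_ext with (fun r => forall x, x = t r -> forall y, y = u r ->
    forall z, z = v r -> P x y z).
  - intros r. split; [auto|intros ? ? -> ? -> ? ->; auto].
  - apply Def_all, Def_imp; auto. apply Def_all, Def_imp; [now apply DefT_lift|].
    apply Def_all, Def_imp; [exact (DefT_lift (DefT_lift Hv))|].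
    apply (Def_ren (fun i => match i with 0 => 2 | 1 => 1 | _ => 0 end) HP).
Qed.

Lemma DefT_app2 (g : V -> V -> V) (t u : env -> V) :
  Def (fun r => r 0 = g (r 1) (r 2)) -> DefT t -> DefT u -> DefT (fun r => g (t r) (u r)).
Proof.
  intros Hg Ht Hu. apply (Def_app3 (fun x y z => x = g y z)); auto using DefT_var, DefT_lift.
Qed.

Lemma Def_cin X (t : env -> V) : DefT t -> Def (fun r => cin M (t r) X).
Proof.
  apply (Def_app1 (fun x => cin M x X)). exists (CIn 0 0), (fun _ => X). cbn. tauto.
Qed.

Lemma Def_sin (t u : env -> V) : DefT t -> DefT u -> Def (fun r => sin M (t r) (u r)).
Proof. apply Def_app2. exists (SIn 0 1), s0. cbn. tauto. Qed.

Lemma Def_eq (t u : env -> V) : DefT t -> DefT u -> Def (fun r => t r = u r).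
Proof. apply Def_app2. exists (SEq 0 1), s0. cbn. tauto. Qed.

Context (comp : forall p, first_order p -> forall r s,
  exists X, forall x, cin M x X <-> sat M (cons_env x r) s p).

(** A set parameter is traded for a class parameter, its singleton. *)
Lemma DefT_const c : DefT (fun _ => c).
Proof.
  destruct (@comp (SEq 0 1) Logic.I (fun _ => c) s0) as [X HX].
  exists (CIn 0 0), (fun _ => X). split; [exact Logic.I|]. intros r. apply HX.
Qed.

Lemma Def_class (P : V -> Prop) : Def (fun r => P (r 0)) ->
  exists X, forall x, cin M x X <-> P x.
Proof.
  intros (p & s & F & H).
  destruct (classic (exists c : V, True)) as [[c _]|N].
  - destruct (comp p F (fun _ => c) s) as [X HX]. exists X. intros x. rewrite HX. apply H.
  - exists (s0 0). intros x. destruct N. eauto.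
Qed.

End Definability.

(** * Meaning of the formulas in a structure *)

Section Vocabulary.

Context (M : structure).
Notation V := (sets M).
Notation "x ∈ y" := (sin M x y) (at level 70).
Notation "x ∈' X" := (cin M x X) (at level 70).

(** The predicates here are spelled so that [rsat] of the corresponding formula is convertible to
    them; this fixes the form of disjunction. *)
Definition Either (P Q : Prop) : Prop := ~ P -> Q.
Definition Empty (x : V) : Prop := forall z, ~ z ∈ x.
Definition Succ (s x : V) : Prop := forall z, z ∈ s <-> Either (z ∈ x) (z = x).
Definition Inductive_set (w : V) : Prop :=
  (exists e, Empty e /\ e ∈ w) /\ (forall x, x ∈ w -> exists s, Succ s x /\ s ∈ w).
Definition Omega (w : V) : Prop :=
  Inductive_set w /\ forall v, Inductive_set v -> forall x, x ∈ w -> x ∈ v.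
Definition InOmega (n : V) : Prop := exists w, Omega w /\ n ∈ w.
Definition Upair (p x y : V) : Prop := forall z, z ∈ p <-> Either (z = x) (z = y).
Definition Pair (p x y : V) : Prop := exists u v, Upair u x x /\ Upair v x y /\ Upair p u v.
Definition PairIn (x y f : V) : Prop := exists p, Pair p x y /\ p ∈ f.
Definition PairInC (x y : V) (F : classes M) : Prop := exists p, Pair p x y /\ p ∈' F.
Definition SingleValued (F : classes M) : Prop :=
  forall x y z, PairInC x y F /\ PairInC x z F -> y = z.
Definition Fun (f d : V) (X : classes M) : Prop :=
  (forall p, p ∈ f -> exists k x, Pair p k x /\ k ∈ d /\ x ∈' X) /\
  (forall k, k ∈ d -> exists x, PairIn k x f /\ forall y, PairIn k y f -> y = x).
Definition Restr (r f n : V) : Prop :=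
  forall p, p ∈ r <-> (p ∈ f /\ exists k y, k ∈ n /\ Pair p k y).

Definition Play (X : classes M) (f : V) : Prop := exists w, Omega w /\ Fun f w X.
Definition Position (X : classes M) (s : V) : Prop := exists n, InOmega n /\ Fun s n X.
Definition Strategy (X T : classes M) : Prop :=
  (forall p, p ∈' T -> exists s x, Pair p s x /\ Position X s /\ x ∈' X) /\
  (forall s, Position X s -> exists x, PairInC s x T /\ forall y, PairInC s y T -> y = x).
Definition Even (n : V) : Prop :=
  exists E, n ∈ E /\ (exists e, Empty e /\ e ∈ E) /\
    forall k s, InOmega k /\ Succ s k -> (s ∈ E <-> ~ k ∈ E).
Definition ToMove (i : player) (n : V) : Prop :=
  match i with I => Even n | II => ~ Even n end.
Definition WonBy (i : player) (A : classes M) (f : V) : Prop :=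
  match i with I => f ∈' A | II => ~ f ∈' A end.
Definition Follows (i : player) (T : classes M) (f : V) : Prop :=
  forall n, InOmega n -> ToMove i n ->
    exists r x, Restr r f n /\ PairIn n x f /\ PairInC r x T.
Definition WinningStrategy (i : player) (X A T : classes M) : Prop :=
  Strategy X T /\ forall f, Play X f -> Follows i T f -> WonBy i A f.
Definition OpenFor (i : player) (X A : classes M) : Prop :=
  forall f, Play X f /\ WonBy i A f ->
    exists n r, InOmega n /\ Restr r f n /\
      forall g, Play X g /\ Restr r g n -> WonBy i A g.
Definition OpenDeterminacy : Prop :=
  forall X A, (exists x, x ∈' X) /\ (forall f, f ∈' A -> Play X f) /\
    Either (OpenFor I X A) (OpenFor II X A) ->
    Either (exists T, WinningStrategy I X A T) (exists T, WinningStrategy II X A T).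

Lemma open_determinacy_iff r s : sat M r s open_determinacy <-> OpenDeterminacy.
Proof. rewrite <- rsat_iff. reflexivity. Qed.

End Vocabulary.

Lemma either_iff P Q : Either P Q <-> P \/ Q.
Proof. unfold Either. tauto. Qed.

Lemma sat_iter_SAll M k q : (forall r s, sat M r s (Nat.iter k SAll q)) ->
  forall r s, sat M r s q.
Proof.
  induction k; auto. cbn. intros H. apply IHk. intros r s.
  specialize (H (fun i => r (S i)) s (r 0)).
  now replace (cons_env (r 0) (fun i => r (S i))) with r in H
    by (apply functional_extensionality; now intros [|i]).
Qed.

Lemma sat_iter_CAll M k q : (forall r s, sat M r s (Nat.iter k CAll q)) ->
  forall r s, sat M r s q.
Proof.
  induction k; auto. cbn. intros H. apply IHk. intros r s.
  specialize (H r (fun i => s (S i)) (s 0)).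
  now replace (cons_env (s 0) (fun i => s (S i))) with s in H
    by (apply functional_extensionality; now intros [|i]).
Qed.

Lemma sat_comprehension M k l p : (forall r s, sat M r s (comprehension k l p)) ->
  forall r s, exists X, forall x, cin M x X <-> sat M (cons_env x r) s p.
Proof.
  intros H r s. unfold comprehension in H.
  pose proof (sat_iter_CAll M l _ (sat_iter_SAll M k _ H) r s) as K.
  cbn in K. apply NNPP. intros N. apply K. intros X HX. apply N. exists X. intros x.
  specialize (HX x). unfold cshift in HX. rewrite sat_ren in HX.
  change (fun i => cons_env x r (nid i)) with (cons_env x r) in HX.
  change (fun i => cons_env X s (S i)) with s in HX. tauto.
Qed.

(** * Set theory inside a fixed model *)

Section Model.

Context (M : structure) (HM : models GBC_Pi11 M) (r0 : nat -> sets M) (s0 : nat -> classes M).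
Notation V := (sets M).
Notation "x ∈ y" := (sin M x y) (at level 70).
Notation "x ∈' X" := (cin M x X) (at level 70).

Lemma model_axiom p : In p base_axioms -> rsat M r0 s0 p.
Proof. intros H. apply rsat_iff. apply HM. left. now apply GBC_base. Qed.

Lemma class_comprehension p : first_order p -> forall r s,
  exists X, forall x, x ∈' X <-> sat M (cons_env x r) s p.
Proof.
  intros F. apply sat_comprehension with (var_bound p) (var_bound p).
  intros r s. apply HM. left. apply GBC_comprehension; auto.
  eapply bounded_mono; eauto using bounded_var_bound.
Qed.

Ltac def_extra := fail.
Ltac def_step := cbv beta; first
  [ assumption
  | lazymatch goal with
    | |- DefT _ _ => first
      [ apply (@DefT_var M s0) | apply (@DefT_const M s0 class_comprehension) | def_extra ]
    | |- Def _ (fun _ => ?P) => apply (@Def_const M s0)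
    | |- Def _ (fun _ => sin _ _ _) => apply (Def_sin s0)
    | |- Def _ (fun _ => cin _ _ _) => apply Def_cin
    | |- Def _ (fun _ => _ = _) => apply (Def_eq s0)
    | |- Def _ (fun _ => ~ _) => apply (Def_not s0)
    | |- Def _ (fun _ => _ /\ _) => apply (Def_and s0)
    | |- Def _ (fun _ => _ \/ _) => apply (Def_or s0)
    | |- Def _ (fun _ => _ <-> _) => apply (Def_iff s0)
    | |- Def _ (fun _ => exists _, _) => apply (Def_ex s0)
    | |- Def _ (fun _ => forall _, _) => first [apply Def_imp | apply Def_all]
    end ].
Ltac def := repeat def_step.

Lemma set_ext x y : (forall z, z ∈ x <-> z ∈ y) -> x = y.
Proof. exact (@model_axiom set_extensionality ltac:(cbn; tauto) x y). Qed.

Lemma eps_induction (P : V -> Prop) : Def M (fun r => P (r 0)) ->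
  (forall x, (forall y, y ∈ x -> P y) -> P x) -> forall x, P x.
Proof.
  intros D H x. apply NNPP. intros N.
  destruct (Def_class s0 class_comprehension (fun x => ~ P x) ltac:(def)) as [C HC].
  assert (F : (exists x, x ∈' C) -> exists x, x ∈' C /\ forall y, y ∈ x -> ~ y ∈' C)
    by exact (@model_axiom foundation ltac:(cbn; tauto) C).
  destruct F as [z [Hz K]].
  - exists x. now apply HC.
  - apply HC in Hz. apply Hz, H. intros y Hy. apply NNPP. intros Hn.
    apply (K y Hy). now apply HC.
Qed.

Lemma upair_ex x y : exists p, forall z, z ∈ p <-> z = x \/ z = y.
Proof.
  assert (H : exists p, Upair M p x y) by exact (@model_axiom pairing ltac:(cbn; tauto) x y).
  destruct H as [p Hp].
  exists p. intros z. rewrite (Hp z). apply either_iff.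
Qed.

Definition upair (x y : V) : V :=
  epsilon (inhabits (r0 0)) (fun p => forall z, z ∈ p <-> z = x \/ z = y).

Lemma upair_spec x y z : z ∈ upair x y <-> z = x \/ z = y.
Proof. apply (epsilon_spec (inhabits (r0 0)) _ (upair_ex x y)). Qed.

Definition pair (x y : V) : V := upair (upair x x) (upair x y).

Lemma Upair_iff p x y : Upair M p x y <-> p = upair x y.
Proof.
  unfold Upair. setoid_rewrite either_iff. split.
  - intros H. apply set_ext. intros z. now rewrite H, upair_spec.
  - intros ->. apply upair_spec.
Qed.

Lemma Pair_iff p x y : Pair M p x y <-> p = pair x y.
Proof.
  unfold Pair. setoid_rewrite Upair_iff. split.
  - intros (u & v & -> & -> & ->). reflexivity.
  - intros ->. now exists (upair x x), (upair x y).
Qed.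

Lemma upair_inj x y z : upair x y = upair x z -> y = z.
Proof.
  intros E. assert (Hy : y ∈ upair x z) by (rewrite <- E; apply upair_spec; auto).
  assert (Hz : z ∈ upair x y) by (rewrite E; apply upair_spec; auto).
  apply upair_spec in Hy, Hz. intuition congruence.
Qed.

Lemma pair_inj x y x' y' : pair x y = pair x' y' -> x = x' /\ y = y'.
Proof.
  intros E. assert (x = x').
  { assert (H : upair x x ∈ pair x' y') by (rewrite <- E; apply upair_spec; auto).
    assert (K : x' ∈ upair x x); [|apply upair_spec in K; intuition congruence].
    apply upair_spec in H. destruct H as [->| ->]; apply upair_spec; auto. }
  subst x'. split; auto. apply upair_inj with x. now apply upair_inj with (upair x x).
Qed.

Lemma pair_eq_iff x y x' y' : pair x y = pair x' y' <-> x = x' /\ y = y'.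
Proof. split; [apply pair_inj|]. now intros [-> ->]. Qed.

Lemma DefT_pair t u : DefT M t -> DefT M u -> DefT M (fun r => pair (t r) (u r)).
Proof.
  apply (DefT_app2 s0). apply Def_ext with (fun r => Pair M (r 0) (r 1) (r 2)).
  - intros r. apply Pair_iff.
  - unfold Pair, Upair, Either. def.
Qed.

Ltac def_extra ::= apply DefT_pair.

Lemma PairInC_iff x y F : PairInC M x y F <-> pair x y ∈' F.
Proof.
  unfold PairInC. setoid_rewrite Pair_iff. split; [now intros (p & -> & H)|eauto].
Qed.

Lemma PairIn_iff x y f : PairIn M x y f <-> pair x y ∈ f.
Proof.
  unfold PairIn. setoid_rewrite Pair_iff. split; [now intros (p & -> & H)|eauto].
Qed.

Lemma relation_class (Q : V -> V -> Prop) : Def M (fun r => Q (r 0) (r 1)) ->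
  exists K, (forall x y, pair x y ∈' K <-> Q x y) /\
    forall z, z ∈' K -> exists x y, z = pair x y.
Proof.
  intros D.
  destruct (Def_class s0 class_comprehension (fun z => exists x y, z = pair x y /\ Q x y)
    ) as [K HK].
  { def. apply (Def_ren (fun i => match i with 0 => 1 | _ => 0 end) D). }
  exists K. split.
  - intros x y. rewrite HK. split; [|eauto].
    intros (x' & y' & E & H). apply pair_inj in E. now destruct E as [-> ->].
  - intros z Hz. apply HK in Hz. destruct Hz as (x & y & -> & _). eauto.
Qed.

Lemma replacement_set (Q : V -> V -> Prop) a : Def M (fun r => Q (r 0) (r 1)) ->
  (forall x y z, Q x y -> Q x z -> y = z) ->
  exists b, forall y, y ∈ b <-> exists x, x ∈ a /\ Q x y.
Proof.
  intros D F. destruct (relation_class Q D) as [K [HK _]].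
  assert (Rp : SingleValued M K -> forall a, exists b, forall y,
    y ∈ b <-> exists x, x ∈ a /\ PairInC M x y K)
    by exact (@model_axiom replacement ltac:(cbn; tauto) K).
  destruct Rp with (a := a) as [b Hb].
  - intros x y z [H1 H2]. apply PairInC_iff in H1, H2. apply HK in H1, H2. eauto.
  - exists b. intros y. rewrite (Hb y).
    split; intros [x [Hx H]]; exists x; split; auto.
    + apply HK. now apply PairInC_iff in H.
    + apply PairInC_iff. now apply HK.
Qed.

Lemma separation_set (P : V -> Prop) a : Def M (fun r => P (r 0)) ->
  exists b, forall x, x ∈ b <-> x ∈ a /\ P x.
Proof.
  intros D. destruct (replacement_set (fun x y => x = y /\ P x) a) as [b Hb].
  - def.
  - intros x y z [<- _] [<- _]. reflexivity.
  - exists b. intros x. rewrite Hb. split.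
    + now intros (y & Hy & <- & Hp).
    + intros []. eauto.
Qed.

Lemma union_set x : exists u, forall z, z ∈ u <-> exists y, z ∈ y /\ y ∈ x.
Proof. exact (@model_axiom union ltac:(cbn; tauto) x). Qed.

Lemma power_set_set x : exists u, forall z, z ∈ u <-> forall y, y ∈ z -> y ∈ x.
Proof. exact (@model_axiom power_set ltac:(cbn; tauto) x). Qed.

Lemma adjoin_set x y : exists u, forall z, z ∈ u <-> z ∈ x \/ z = y.
Proof.
  destruct (union_set (upair x (upair y y))) as [u Hu]. exists u. intros z. rewrite Hu.
  setoid_rewrite upair_spec. split.
  - intros (w & Hz & [-> | ->]); auto. apply upair_spec in Hz. tauto.
  - intros [H| ->]; [eauto|]. exists (upair y y). rewrite upair_spec. auto.
Qed.

(** * Natural numbers *)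

Definition adjoin (x y : V) : V :=
  epsilon (inhabits (r0 0)) (fun u => forall z, z ∈ u <-> z ∈ x \/ z = y).

Lemma adjoin_spec x y z : z ∈ adjoin x y <-> z ∈ x \/ z = y.
Proof. apply (epsilon_spec (inhabits (r0 0)) _ (adjoin_set x y)). Qed.

Definition succ (x : V) : V := adjoin x x.

Lemma succ_spec x z : z ∈ succ x <-> z ∈ x \/ z = x.
Proof. apply adjoin_spec. Qed.

Lemma Succ_iff s x : Succ M s x <-> s = succ x.
Proof.
  unfold Succ. setoid_rewrite either_iff. split.
  - intros H. apply set_ext. intros z. now rewrite H, succ_spec.
  - intros ->. apply succ_spec.
Qed.

Lemma DefT_adjoin t u : DefT M t -> DefT M u -> DefT M (fun r => adjoin (t r) (u r)).
Proof.
  apply (DefT_app2 s0).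
  apply Def_ext with (fun r => forall z, z ∈ r 0 <-> z ∈ r 1 \/ z = r 2).
  - intros r. split; [|intros ->; apply adjoin_spec].
    intros H. apply set_ext. intros z. now rewrite H, adjoin_spec.
  - def.
Qed.

Ltac def_extra ::= first [apply DefT_pair | apply DefT_adjoin].

Lemma empty_ex : exists x, Empty M x.
Proof.
  destruct (separation_set (fun _ => False) (r0 0)) as [x Hx].
  { def. }
  exists x. intros z Hz. now apply Hx in Hz.
Qed.

Definition zero : V := epsilon (inhabits (r0 0)) (Empty M).

Lemma zero_spec z : ~ z ∈ zero.
Proof. apply (epsilon_spec (inhabits (r0 0)) _ empty_ex). Qed.

Lemma Empty_iff x : Empty M x <-> x = zero.
Proof.
  split; [|intros ->; exact zero_spec].
  intros H. apply set_ext. intros z. split; intros K; [now apply H in K|now apply zero_spec in K].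
Qed.

Lemma Inductive_set_iff w :
  Inductive_set M w <-> zero ∈ w /\ forall x, x ∈ w -> succ x ∈ w.
Proof.
  unfold Inductive_set. setoid_rewrite Empty_iff. setoid_rewrite Succ_iff. split.
  - intros [(e & -> & H) K]. split; auto. intros x Hx. now destruct (K x Hx) as (s & -> & Hs).
  - intros [H K]. split; [now exists zero|]. intros x Hx. exists (succ x). auto.
Qed.

Lemma omega_ex : exists w, Omega M w.
Proof.
  assert (H : exists w, Inductive_set M w) by exact (@model_axiom infinity ltac:(cbn; tauto)).
  destruct H as [w Hw].
  destruct (separation_set (fun x => forall v, Inductive_set M v -> x ∈ v) w) as [u Hu].
  { unfold Inductive_set, Empty, Succ, Either. def. }
  exists u. split.
  - apply Inductive_set_iff. split.
    + apply Hu. split; [now apply Inductive_set_iff in Hw|].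
      intros v Hv. now apply Inductive_set_iff in Hv.
    + intros x Hx. apply Hu in Hx. destruct Hx as [Hx K]. apply Hu. split.
      * apply Inductive_set_iff in Hw. now apply Hw.
      * intros v Hv. specialize (K v Hv). apply Inductive_set_iff in Hv. now apply Hv.
  - intros v Hv x Hx. apply Hu in Hx. now apply Hx.
Qed.

Definition omega : V := epsilon (inhabits (r0 0)) (Omega M).

Lemma omega_spec : Omega M omega.
Proof. apply (epsilon_spec (inhabits (r0 0)) _ omega_ex). Qed.

Lemma Omega_iff w : Omega M w <-> w = omega.
Proof.
  split; [|intros ->; exact omega_spec].
  intros [H K]. destruct omega_spec as [H' K']. apply set_ext. intros z.
  split; intros Hz; [now apply K|now apply K'].
Qed.

Lemma InOmega_iff n : InOmega M n <-> n ∈ omega.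
Proof.
  unfold InOmega. setoid_rewrite Omega_iff. split; [now intros (w & -> & H)|eauto].
Qed.

Lemma zero_omega : zero ∈ omega.
Proof. destruct omega_spec as [H _]. now apply Inductive_set_iff in H. Qed.

Lemma succ_omega n : n ∈ omega -> succ n ∈ omega.
Proof. destruct omega_spec as [H _]. apply Inductive_set_iff in H. apply H. Qed.

Lemma omega_induction (P : V -> Prop) : Def M (fun r => P (r 0)) -> P zero ->
  (forall n, n ∈ omega -> P n -> P (succ n)) -> forall n, n ∈ omega -> P n.
Proof.
  intros D H0 HS n Hn. destruct (separation_set P omega D) as [v Hv].
  apply Hv. destruct omega_spec as [_ K]. apply K; auto.
  apply Inductive_set_iff. split.
  - apply Hv. auto using zero_omega.
  - intros x Hx. apply Hv in Hx. destruct Hx. apply Hv. auto using succ_omega.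
Qed.

Lemma omega_trans n : n ∈ omega -> forall k, k ∈ n -> k ∈ omega.
Proof.
  revert n. apply (omega_induction (fun n => forall k, k ∈ n -> k ∈ omega)); [def| |].
  - intros k Hk. now apply zero_spec in Hk.
  - intros n Hn IH k Hk. apply succ_spec in Hk. destruct Hk as [Hk| ->]; auto.
Qed.

(** * Stage comparison *)

(* The only formula with a class quantifier to which comprehension is applied.  The class parameter
   [K] holds the triples [((p, a), b)] with [kappa p a b]. *)
Definition stage_formula : form :=
  let x := SVar 0 in
  let K := CVar 0 in
  let kappa p a b := (∃ₛ t, is_pair t p a ∧ pair_inC t b K)%fm in
  (∀ₖ Y,
    (∀ₛ p q,
      (∃ₛ a, ∀ₛ b, kappa p a b ⇒
        ¬ ∃ₛ a', ∀ₛ b', kappa q a' b' ⇒ ¬ pair_inC b b' Y) ⇒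
      pair_inC p q Y) ⇒
    x ∈ₖ Y)%fm 1 1.

(** One round of a game: a choice [a], then any answer [b] permitted by [kappa], with the aim of
    landing in [Y]. The choice ranges over all sets, so each [kappa] has to penalize illegal choices
    itself. *)
Definition gam (kappa : V -> V -> V -> Prop) (Y : V -> Prop) (p : V) : Prop :=
  exists a, forall b, kappa p a b -> Y b.

Section Stages.

Context (kappa : V -> V -> V -> Prop)
  (Def_kappa : Def M (fun r => kappa (r 0) (r 1) (r 2))).

Ltac def_atom :=
  lazymatch goal with
  | |- Def _ (fun _ => kappa _ _ _) => apply (Def_app3 kappa Def_kappa)
  end.
Ltac def ::= repeat first [def_step | def_atom].

Lemma stage_class : exists R : classes M, forall x, x ∈' R <->
  forall Y : classes M,
    (forall p q, gam kappa (fun b => ~ gam kappa (fun b' => ~ pair b b' ∈' Y) q) p ->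
      pair p q ∈' Y) -> x ∈' Y.
Proof.
  destruct (Def_class s0 class_comprehension
    (fun z => exists p a b, z = pair (pair p a) b /\ kappa p a b)) as [K HK].
  { def. }
  assert (HK' : forall p a b, (exists t, Pair M t p a /\ PairInC M t b K) <-> kappa p a b).
  { intros p a b. setoid_rewrite Pair_iff. setoid_rewrite PairInC_iff. setoid_rewrite HK.
    split.
    - intros (t & -> & p' & a' & b' & E & H). rewrite !pair_eq_iff in E.
      now destruct E as [[-> ->] ->].
    - intros H. exists (pair p a). split; auto. now exists p, a, b. }
  assert (B : exists q, stage_formula = CAll q /\ first_order q /\ bounded 1 1 (CAll q)).
  { eexists. split; [reflexivity|]. split; cbn; repeat split; lia. }
  destruct B as (q & Eq & Fq & Bq).
  assert (C := sat_comprehension M 0 1 (CAll q)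
    (@HM (comprehension 0 1 (CAll q)) (or_intror (Pi11_instance q Fq Bq))) r0
    (cons_env K s0)).
  destruct C as [R HR]. exists R. intros x. rewrite HR, <- Eq, <- rsat_iff.
  transitivity (forall Y,
    (forall p q, (exists a, forall b, (exists t, Pair M t p a /\ PairInC M t b K) ->
       ~ exists a', forall b', (exists t, Pair M t q a' /\ PairInC M t b' K) ->
         ~ PairInC M b b' Y) -> PairInC M p q Y) -> x ∈' Y).
  { reflexivity. }
  setoid_rewrite HK'. setoid_rewrite PairInC_iff. reflexivity.
Qed.

Notation Gam := (gam kappa).

Lemma gam_mono (A B : V -> Prop) p : (forall b, A b -> B b) -> Gam A p -> Gam B p.
Proof. intros H [a Ha]. exists a. auto. Qed.

Lemma gam_all (A : V -> Prop) p : (forall b, A b) -> Gam A p.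
Proof. intros H. exists p. auto. Qed.

(** Contrapositive of monotonicity. It stands in for ordinal arithmetic below: it produces an option
    of [p] whose rank lies between two bounds. *)
Lemma gam_diff (A B : V -> Prop) p : Gam A p -> ~ Gam B p -> exists b, A b /\ ~ B b.
Proof.
  intros HA HB. apply NNPP. intros N. apply HB. revert HA. apply gam_mono.
  intros b Hb. apply NNPP. intros Hn. eauto.
Qed.

(* Let the rank of [p] be the stage at which [p] enters the least fixed point of [Gam], infinite
   if it never does.  [R p q] says that [p] has an ordinal rank, at most that of [q], and
   [L p q] that the rank of [p] is below that of [q]. *)
Context (Rc : classes M) (HRc : forall x, x ∈' Rc <->
  forall Y : classes M,
    (forall p q, Gam (fun b => ~ Gam (fun b' => ~ pair b b' ∈' Y) q) p -> pair p q ∈' Y) ->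
    x ∈' Y).

Definition R p q := pair p q ∈' Rc.
Definition L p q := ~ Gam (fun b => ~ R p b) q.

Lemma R_ind (Z : V -> V -> Prop) : Def M (fun r => Z (r 0) (r 1)) ->
  (forall p q, Gam (fun b => ~ Gam (fun b' => ~ Z b b') q) p -> Z p q) ->
  forall p q, R p q -> Z p q.
Proof.
  intros D H p q Hpq. destruct (relation_class Z D) as [Y [HY _]].
  apply HY. apply HRc; auto. intros p' q' K. apply HY, H. revert K.
  apply gam_mono. intros b N K. apply N. revert K. apply gam_mono.
  intros b'. now rewrite HY.
Qed.

Lemma R_intro p q : Gam (fun b => L b q) p -> R p q.
Proof.
  intros H. apply HRc. intros Y HY. apply HY. revert H. apply gam_mono.
  intros b N K. apply N. revert K. apply gam_mono. intros b' K K'. apply K.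
  now apply HRc.
Qed.

Lemma R_elim p q : R p q -> Gam (fun b => L b q) p.
Proof.
  revert p q. apply (R_ind (fun p q => Gam (fun b => L b q) p)).
  - unfold L, R, gam. def.
  - intros p q. apply gam_mono. intros b N K. apply N. revert K. apply gam_mono.
    intros b' K K'. apply K. now apply R_intro.
Qed.

Arguments R_elim {p q} _.

Lemma R_trans p q t : R p q -> R q t -> R p t.
Proof.
  intros H K. revert q t K p H. apply (R_ind (fun q t => forall p, R p q -> R p t)).
  - unfold R. def.
  - intros q t H p Hp. apply R_intro. apply R_elim in Hp. revert Hp. apply gam_mono.
    intros b Hb. destruct (gam_diff H Hb) as (b' & N & K). apply NNPP in K.
    intros G. apply N. revert G. apply gam_mono. intros c Hc Hz. apply Hc. now apply Hz.
Qed.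

Arguments R_trans {p q t} _ _.

Definition W p := exists q, R p q.

(** [R_ind] is applied to a relation that ignores its second argument. If [Z b] failed, the inner
    predicate would hold everywhere and [gam_all] would refute the hypothesis on [b]. *)
Lemma W_ind (Z : V -> Prop) : Def M (fun r => Z (r 0)) ->
  (forall p, Gam Z p -> Z p) -> forall p, W p -> Z p.
Proof.
  intros D H p [q Hpq]. revert p q Hpq. apply (R_ind (fun p _ => Z p)).
  - exact D.
  - intros p q G. apply H. revert G. apply gam_mono. intros b Hb. apply NNPP.
    intros N. apply Hb. now apply gam_all.
Qed.

Lemma L_W p q : L p q -> W p.
Proof.
  intros H. apply NNPP. intros N. apply H. apply gam_all. intros b Hb. apply N. now exists b.
Qed.

Arguments L_W {p q} _.

Definition undecided p q := ~ L p q /\ ~ R q p.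
Definition decided q := forall p, ~ undecided p q.

(* An undecided pair [(p, q)] yields another one ending in [p], so a decided element is comparable
   with every other from either side. *)
Lemma undecided_next p q : undecided p q -> exists t, undecided t p.
Proof.
  intros [H K]. apply NNPP in H.
  destruct (gam_diff H (fun G => K (R_intro G))) as (t & N & N').
  exists t. now split.
Qed.

Lemma decided_lr p q : decided p \/ decided q -> L p q \/ R q p.
Proof.
  intros H. apply NNPP. intros N.
  assert (U : undecided p q) by (split; tauto).
  destruct H as [H|H]; [|now apply (H p)].
  destruct (undecided_next U) as [t Ht]. now apply (H t).
Qed.

(** Decidedness is carried downward along [R] to make the induction work. An element occurring in an
    undecided pair is pushed by [gam_diff] below some option already handled, so it is decided; yet
    [undecided_next] puts it in second place of another undecided pair. *)
Lemma gam_decided q : Gam (fun b => decided b /\ forall p, R p b -> decided p) q ->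
  decided q /\ forall p, R p q -> decided p.
Proof.
  intros G. split.
  - intros p [H K]. destruct (gam_diff G (fun G' => K (R_intro G'))) as (b & [Hb Hb'] & N).
    assert (Rp : R p b) by (destruct (@decided_lr b p (or_introl Hb)); tauto).
    assert (U : undecided p q) by now split.
    destruct (undecided_next U) as [t Ht]. now apply (Hb' p Rp t).
  - intros p Hp t [H K].
    destruct (gam_diff (R_elim Hp) (fun G' => K (R_intro G'))) as (b & Hb & N).
    destruct (gam_diff G Hb) as (c & [_ Hc] & Rc'). apply NNPP in Rc'.
    assert (Db := Hc b Rc').
    assert (Rt : R t b) by (destruct (@decided_lr b t (or_introl Db)); tauto).
    assert (Dt := Hc t (R_trans Rt Rc')).
    destruct (undecided_next (conj H K)) as [u Hu]. now apply (Dt u).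
Qed.

Lemma W_decided q : W q -> decided q /\ forall p, R p q -> decided p.
Proof.
  revert q. apply (@W_ind (fun q => decided q /\ forall p, R p q -> decided p));
    [|apply gam_decided].
  unfold decided, undecided, L, R, gam. def.
Qed.

(** The witness is [p] itself: [p] is decided, so [L p p] or [R p p], and either one gives [W p]. *)
Lemma W_closed p : Gam W p -> W p.
Proof.
  intros G. destruct (classic (L p p)) as [H|H]; [now apply L_W in H|].
  exists p. destruct (@decided_lr p p); auto; [|tauto].
  left. apply gam_decided. revert G. apply gam_mono. apply W_decided.
Qed.

(** Without a minimal element, no member of [P] is [R]-below any [q] in [W], by induction on [q]:
    from [t] in [P] with [R t v] one descends to [b] in [P] with [L b t], and two uses of [gam_diff]
    give an option [z] of [v] with [R b z]. *)
Lemma L_wf (P : V -> Prop) : Def M (fun r => P (r 0)) ->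
  (exists p, W p /\ P p) -> exists p, W p /\ P p /\ forall b, P b -> ~ L b p.
Proof.
  intros D [p [[q Hpq] Hp]]. apply NNPP. intros N.
  assert (K : forall q, W q -> forall p, P p -> ~ R p q).
  { apply (@W_ind (fun q => forall p, P p -> ~ R p q)).
    { unfold R. def. }
    intros v G t Ht Rt.
    assert (E : exists b, P b /\ L b t).
    { apply NNPP. intros N'. apply N. exists t. split; [now exists v|]. split; auto.
      intros b Hb Lb. eauto. }
    destruct E as (b & Hb & Lb).
    destruct (gam_diff (R_elim Rt) Lb) as (x & Lx & Rb). apply NNPP in Rb.
    destruct (gam_diff G Lx) as (z & Hz & Rx). apply NNPP in Rx.
    apply (Hz b Hb). exact (R_trans Rb Rx). }
  assert (G : Gam W p) .
  { generalize (R_elim Hpq). apply gam_mono. intros b. apply L_W. }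
  assert (Wp := W_closed G).
  assert (Lp : L p p).
  { destruct (@decided_lr p p (or_introl (proj1 (W_decided Wp)))) as [H|H]; auto.
    destruct (K p Wp p Hp H). }
  destruct (gam_diff G Lp) as (b & Wb & Rb). apply NNPP in Rb.
  exact (K b Wb p Hp Rb).
Qed.

Lemma L_irrefl p : W p -> ~ L p p.
Proof.
  intros H. assert (D : Def M (fun r => r 0 = p)) by def.
  destruct (@L_wf (fun x => x = p) D) as (q & _ & -> & Hq); eauto.
Qed.

Lemma W_elim p : W p -> exists a, forall b, kappa p a b -> L b p /\ W b.
Proof.
  intros H. destruct (@decided_lr p p) as [K|K].
  - left. now apply W_decided.
  - now apply L_irrefl in K.
  - apply R_elim in K. destruct K as [a Ha]. exists a. intros b Hb. split; eauto using L_W.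
Qed.

End Stages.

(** The interface for both applications: closure of the fixed point, a choice at each of its
    elements that lowers the rank against every answer, and well-foundedness of the rank
    comparison. *)
Theorem stage_comparison (kappa : V -> V -> V -> Prop) :
  Def M (fun r => kappa (r 0) (r 1) (r 2)) ->
  exists W L : classes M,
    (forall p, gam kappa (fun b => b ∈' W) p -> p ∈' W) /\
    (forall p, p ∈' W -> exists a, forall b, kappa p a b -> pair b p ∈' L /\ b ∈' W) /\
    (forall P : V -> Prop, Def M (fun r => P (r 0)) -> (exists p, p ∈' W /\ P p) ->
      exists p, p ∈' W /\ P p /\ forall b, P b -> ~ pair b p ∈' L).
Proof.
  intros D. destruct (stage_class kappa D) as [Rc HRc].
  destruct (Def_class s0 class_comprehension (W Rc)) as [Wc HW]; [unfold W, R; def|].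
  assert (DL : Def M (fun r => L kappa Rc (r 0) (r 1))).
  { unfold L, R, gam. def. apply (Def_app3 kappa D); def. }
  destruct (relation_class (L kappa Rc) DL) as [Lc [HL _]].
  exists Wc, Lc. repeat split.
  - intros p. rewrite HW. intros G. apply (W_closed D HRc).
    revert G. apply gam_mono. intros b. apply HW.
  - intros p Hp. apply HW in Hp. destruct (W_elim D HRc Hp) as [a Ha].
    exists a. intros b. rewrite HL, HW. apply Ha.
  - intros P DP (p & Hp & HP). apply HW in Hp.
    destruct (L_wf D HRc P DP) as (q & H1 & H2 & H3); eauto.
    exists q. rewrite HW. repeat split; auto. intros b Hb. rewrite HL. auto.
Qed.

(** * Ranks of sets and choice from classes *)

(* [below q x] says that the rank of the set [x] is below that of [q]; the loop at [b = p] rules out the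
   options [a] that are not elements of [q]. *)
Lemma below_ex : exists below : V -> V -> Prop, Def M (fun r => below (r 0) (r 1)) /\
  forall q x, below q x <-> exists y, y ∈ q /\ forall z, z ∈ x -> below y z.
Proof.
  (* The rank of [x] is below that of [q] iff some [a] in [q] has at least the rank of [x], that is,
     iff every [z] in [x] has rank below that of [a]. *)
  set (kappa := fun p a b => exists q x, p = pair q x /\
    ((a ∈ q /\ exists z, z ∈ x /\ b = pair a z) \/ (~ a ∈ q /\ b = p))).
  destruct (stage_comparison kappa) as (W & L & H1 & H2 & H3); [unfold kappa; def|].
  exists (fun q x => pair q x ∈' W). split; [def|].
  intros q x. split.
  - intros H. destruct (H2 _ H) as [a Ha].
    assert (K : ~ pair (pair q x) (pair q x) ∈' L).
    { destruct (H3 (fun p => p = pair q x)) as (p & _ & -> & Hp); eauto. def. }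
    assert (Hq : a ∈ q).
    { apply NNPP. intros N. apply K. apply (Ha (pair q x)). exists q, x. auto. }
    exists a. split; auto. intros z Hz. apply Ha. exists q, x. split; eauto 6.
  - intros (y & Hy & H). apply H1. exists y. intros b (q' & x' & E & Hb).
    apply pair_inj in E. destruct E as [<- <-].
    destruct Hb as [(_ & z & Hz & ->)|[N _]]; [auto|tauto].
Qed.

Section Rank.

Context (below : V -> V -> Prop) (Def_below : Def M (fun r => below (r 0) (r 1)))
  (below_iff : forall q x, below q x <-> exists y, y ∈ q /\ forall z, z ∈ x -> below y z).

Ltac def_atom :=
  lazymatch goal with
  | |- Def _ (fun _ => below _ _) => apply (Def_app2 below Def_below)
  end.
Ltac def ::= repeat first [def_step | def_atom].

Definition rank_le q x := forall y, y ∈ q -> below x y.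

Lemma below_rank_le q x : below q x <-> exists y, y ∈ q /\ rank_le x y.
Proof. apply below_iff. Qed.

(** If some [y] in [q] is not below [x], then by induction every [z] in [x] is below [y], and [y]
    witnesses [below q x]. *)
Lemma rank_total x : forall q, below q x \/ rank_le q x.
Proof.
  revert x. apply (eps_induction (fun x => forall q, below q x \/ rank_le q x)).
  { unfold rank_le. def. }
  intros x IH q. apply NNPP. intros N. apply not_or_and in N. destruct N as [N N'].
  apply N'. intros y Hy. apply NNPP. intros Hn. apply N. apply below_iff.
  exists y. split; auto. intros z Hz. destruct (IH z Hz y); auto.
  exfalso. apply Hn. apply below_rank_le. eauto.
Qed.

Lemma rank_le_refl x : rank_le x x.
Proof.
  revert x. apply (eps_induction (fun x => rank_le x x)); [unfold rank_le; def|].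
  intros x IH y Hy. apply below_rank_le. eauto.
Qed.

Lemma rank_le_trans z : forall x y, rank_le x y -> rank_le y z -> rank_le x z.
Proof.
  revert z. apply (eps_induction (fun z => forall x y,
    rank_le x y -> rank_le y z -> rank_le x z)); [unfold rank_le; def|].
  intros z IH x y Hxy Hyz w Hw. apply Hxy in Hw. apply below_rank_le in Hw.
  destruct Hw as (y' & Hy' & Hw). apply Hyz in Hy'. apply below_rank_le in Hy'.
  destruct Hy' as (z' & Hz' & Hy'). apply below_rank_le. eauto.
Qed.

Lemma rank_minimal (P : V -> Prop) : Def M (fun r => P (r 0)) -> (exists x, P x) ->
  exists x, P x /\ forall y, P y -> ~ below x y.
Proof.
  intros D [c Hc]. apply NNPP. intros N.
  assert (K : forall x c, P c -> ~ rank_le c x).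
  { apply (eps_induction (fun x => forall c, P c -> ~ rank_le c x)).
    { unfold rank_le. def. }
    intros x IH d Hd Hdx.
    assert (E : exists e, P e /\ below d e).
    { apply NNPP. intros N'. apply N. exists d. split; eauto. }
    destruct E as (e & He & Hde). apply below_rank_le in Hde.
    destruct Hde as (y & Hy & Hey). apply Hdx in Hy. apply below_rank_le in Hy.
    destruct Hy as (x' & Hx' & Hy). apply (IH x' Hx' e He). now apply rank_le_trans with y. }
  apply (K c c Hc), rank_le_refl.
Qed.

(** This is the cumulative level indexed by the rank of [q], built as the union over [y] in [q] of
    the power sets of the levels of [y]. *)
Lemma below_set q : exists v, forall x, x ∈ v <-> below q x.
Proof.
  revert q. apply (eps_induction (fun q => exists v, forall x, x ∈ v <-> below q x)); [def|].
  intros q IH.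
  destruct (replacement_set (fun y u => forall z, z ∈ u <-> forall w, w ∈ z -> below y w) q)
    as [b Hb]; [def| |].
  { intros y u u' H H'. apply set_ext. intros z. now rewrite H, H'. }
  destruct (union_set b) as [v Hv]. exists v. intros x. rewrite Hv, below_iff.
  setoid_rewrite Hb. split.
  - intros (u & Hx & y & Hy & Hu). exists y. split; auto. now apply Hu.
  - intros (y & Hy & H). destruct (IH y Hy) as [vy Hvy].
    destruct (power_set_set vy) as [u Hu]. setoid_rewrite Hvy in Hu.
    exists u. split; [now apply Hu|]. eauto.
Qed.

(** Elements of least rank have rank at most that of a fixed [x0] in [P], so they are subsets of the
    level of [x0] and can be separated from its power set. *)
Lemma rank_minimal_set (P : V -> Prop) : Def M (fun r => P (r 0)) -> (exists x, P x) ->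
  exists c, forall x, x ∈ c <-> P x /\ forall y, P y -> ~ below x y.
Proof.
  intros D H. destruct (rank_minimal P D H) as (x0 & Hx0 & _).
  destruct (below_set x0) as [v Hv]. destruct (power_set_set v) as [u Hu].
  destruct (separation_set (fun x => P x /\ forall y, P y -> ~ below x y) u) as [c Hcc].
  { def. }
  exists c. intros x. rewrite Hcc, Hu. split; [tauto|].
  intros [Hx K]. split; auto. intros y Hy. apply Hv.
  destruct (rank_total x0 x) as [B|B]; [destruct (K x0 Hx0 B)|now apply B].
Qed.

(** Global choice selects only from sets, so it is applied to the set [c] of values of least
    rank. *)
Lemma class_choice (Q : V -> V -> Prop) : Def M (fun r => Q (r 0) (r 1)) ->
  exists G : V -> V -> Prop, Def M (fun r => G (r 0) (r 1)) /\
    (forall x y, G x y -> Q x y) /\ (forall x y z, G x y -> G x z -> y = z) /\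
    (forall x, (exists y, Q x y) -> exists y, G x y).
Proof.
  intros D.
  assert (GC : exists F, SingleValued M F /\
    forall x, (exists z, z ∈ x) -> exists y, y ∈ x /\ PairInC M x y F)
    by exact (@model_axiom global_choice ltac:(cbn; tauto)).
  destruct GC as (F & HF & HC).
  set (least := fun x w => Q x w /\ forall d, Q x d -> ~ below w d).
  assert (Dl : Def M (fun r => least (r 0) (r 1))).
  { unfold least. def; apply (Def_app2 Q D); def. }
  exists (fun x y => exists c, (forall w, w ∈ c <-> least x w) /\ pair c y ∈' F /\ y ∈ c).
  repeat split.
  - def. apply (Def_app2 least Dl); def.
  - intros x y (c & Hc & _ & Hy). apply Hc in Hy. apply Hy.
  - intros x y z (c & Hc & Hy & _) (c' & Hc' & Hz & _).
    assert (c = c') as <- by (apply set_ext; intros w; now rewrite Hc, Hc').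
    apply HF with c. now rewrite !PairInC_iff.
  - intros x Hx. assert (DQ : Def M (fun r => Q x (r 0))) by (apply (Def_app2 Q D); def).
    destruct (rank_minimal_set (Q x) DQ Hx) as [c Hc].
    destruct (HC c) as (y & Hy & HyF).
    + destruct (rank_minimal (Q x) DQ Hx) as (w & Hw). exists w. now apply Hc.
    + exists y, c. rewrite PairInC_iff in HyF. auto.
Qed.

End Rank.

Theorem global_class_choice (Q : V -> V -> Prop) : Def M (fun r => Q (r 0) (r 1)) ->
  exists G : V -> V -> Prop, Def M (fun r => G (r 0) (r 1)) /\
    (forall x y, G x y -> Q x y) /\ (forall x y z, G x y -> G x z -> y = z) /\
    (forall x, (exists y, Q x y) -> exists y, G x y).
Proof.
  destruct below_ex as (below & D & H). exact (class_choice below D H Q).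
Qed.

(** * Open games *)

Lemma Restr_iff r f n :
  Restr M r f n <-> forall p, p ∈ r <-> p ∈ f /\ exists k y, k ∈ n /\ p = pair k y.
Proof. unfold Restr. setoid_rewrite Pair_iff. reflexivity. Qed.

Lemma Restr_unique r r' f n : Restr M r f n -> Restr M r' f n -> r = r'.
Proof.
  intros H H'. apply set_ext. intros z. now rewrite (H z), (H' z).
Qed.

Lemma Restr_ex f n : exists r, Restr M r f n.
Proof.
  destruct (separation_set (fun p => exists k y, k ∈ n /\ p = pair k y) f) as [r Hr]; [def|].
  exists r. now apply Restr_iff.
Qed.

Lemma Restr_zero r f : Restr M r f zero -> r = zero.
Proof.
  intros H. apply set_ext. intros z. split; intros Hz; [|now apply zero_spec in Hz].
  apply H in Hz. destruct Hz as (_ & k & _ & Hk & _). now apply zero_spec in Hk.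
Qed.

Lemma Restr_succ r r' f n x : Restr M r f n -> Restr M r' f (succ n) ->
  (forall y, pair n y ∈ f <-> y = x) -> r' = adjoin r (pair n x).
Proof.
  rewrite !Restr_iff. intros H H' K. apply set_ext. intros z.
  rewrite H', adjoin_spec, H. split.
  - intros (Hz & k & y & Hk & ->). apply succ_spec in Hk. destruct Hk as [Hk| ->]; eauto 6.
    right. apply K in Hz. now subst y.
  - intros [(Hz & k & y & Hk & ->)| ->]; (split; [|do 2 eexists; split; [|reflexivity]]).
    + exact Hz.
    + apply succ_spec. auto.
    + now apply K.
    + apply succ_spec. auto.
Qed.

(** * Plays, positions and strategies over a class of moves *)

Section Functions.

Context (X : classes M).

Lemma Fun_iff f d : Fun M f d X <->
  (forall p, p ∈ f -> exists k x, p = pair k x /\ k ∈ d /\ x ∈' X) /\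
  (forall k, k ∈ d -> exists x, forall y, pair k y ∈ f <-> y = x).
Proof.
  unfold Fun. setoid_rewrite PairIn_iff. setoid_rewrite Pair_iff. split.
  - intros [H K]. split; auto. intros k Hk. destruct (K k Hk) as (x & Hx & Hy).
    exists x. intros y. split; [apply Hy|]. now intros ->.
  - intros [H K]. split; auto. intros k Hk. destruct (K k Hk) as (x & Hx).
    exists x. split; [now apply Hx|]. intros y. apply Hx.
Qed.

Lemma Fun_dom f d k x : Fun M f d X -> pair k x ∈ f -> k ∈ d /\ x ∈' X.
Proof.
  intros H Hk. apply Fun_iff in H. apply H in Hk. destruct Hk as (k' & x' & E & Hk').
  apply pair_inj in E. destruct E as [<- <-]. exact Hk'.
Qed.

Lemma Fun_length f d d' : Fun M f d X -> Fun M f d' X -> d = d'.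
Proof.
  intros H H'. apply set_ext. intros k. split; intros Hk.
  - apply Fun_iff in H as [_ K]. destruct (K k Hk) as [x Hx].
    apply (Fun_dom k x H'). now apply Hx.
  - apply Fun_iff in H' as [_ K]. destruct (K k Hk) as [x Hx].
    apply (Fun_dom k x H). now apply Hx.
Qed.

Lemma Play_iff f : Play M X f <-> Fun M f omega X.
Proof.
  unfold Play. setoid_rewrite Omega_iff. split; [now intros (w & -> & H)|eauto].
Qed.

Lemma Position_iff s : Position M X s <-> exists n, n ∈ omega /\ Fun M s n X.
Proof. unfold Position. setoid_rewrite InOmega_iff. reflexivity. Qed.

Lemma Restr_Fun f n r : n ∈ omega -> Fun M f omega X -> Restr M r f n -> Fun M r n X.
Proof.
  rewrite Restr_iff, !Fun_iff. intros Hn [H K] HR. split.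
  - intros p Hp. apply HR in Hp. destruct Hp as (Hp & k & y & Hk & ->).
    destruct (H _ Hp) as (k' & x & E & _ & Hx). apply pair_inj in E.
    destruct E as [<- <-]. eauto.
  - intros k Hk. destruct (K k (omega_trans n Hn k Hk)) as [x Hx]. exists x. intros y.
    rewrite <- Hx, HR. split; [tauto|]. eauto.
Qed.

Lemma Def_Fun : Def M (fun r => Fun M (r 0) (r 1) X).
Proof. unfold Fun, PairIn, Pair, Upair, Either. def. Qed.

Lemma Def_Restr : Def M (fun r => Restr M (r 0) (r 1) (r 2)).
Proof. unfold Restr, Pair, Upair, Either. def. Qed.

Lemma Def_ToMove i : Def M (fun r => ToMove M i (r 0)).
Proof.
  destruct i; unfold ToMove, Even, InOmega, Omega, Inductive_set, Empty, Succ, Either; def.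
Qed.

Lemma Def_WonBy i A : Def M (fun r => WonBy M i A (r 0)).
Proof. destruct i; unfold WonBy; def. Qed.

Ltac def_atom :=
  lazymatch goal with
  | |- Def _ (fun _ => Fun _ _ _ _) => apply (Def_app2 (fun s n => Fun M s n X) Def_Fun)
  | |- Def _ (fun _ => Restr _ _ _ _) => apply (Def_app3 (Restr M) Def_Restr)
  | |- Def _ (fun _ => ToMove _ ?i _) => apply (Def_app1 (ToMove M i) (Def_ToMove i))
  | |- Def _ (fun _ => WonBy _ ?i ?A _) => apply (Def_app1 (WonBy M i A) (Def_WonBy i A))
  end.
Ltac def ::= repeat first [def_step | def_atom].

(** A strategy is total on positions, so a move is demanded even where the player is not to move;
    the [Q] used later are vacuous there and a default move suffices. *)
Lemma strategy_ex (Q : V -> V -> Prop) : Def M (fun r => Q (r 0) (r 1)) ->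
  (forall s n, n ∈ omega -> Fun M s n X -> exists x, x ∈' X /\ Q s x) ->
  exists T, Strategy M X T /\ forall s x, PairInC M s x T -> Q s x.
Proof.
  intros D H.
  destruct (global_class_choice
    (fun s x => (exists n, n ∈ omega /\ Fun M s n X) /\ x ∈' X /\ Q s x))
    as (G & DG & GQ & GF & GE).
  { def. }
  destruct (relation_class G DG) as (T & HT & HT').
  exists T. unfold Strategy. setoid_rewrite Position_iff. setoid_rewrite PairInC_iff.
  setoid_rewrite Pair_iff. repeat split.
  - intros p Hp. destruct (HT' p Hp) as (s & x & ->). apply HT, GQ in Hp.
    exists s, x. tauto.
  - intros s (n & Hn & Hs). destruct (GE s) as [x Hx].
    + destruct (H s n Hn Hs) as (x & Hx & K). exists x. eauto.
    + exists x. split; [now apply HT|]. intros y Hy. apply HT in Hy. eauto.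
  - intros s x Hx. apply HT, GQ in Hx. tauto.
Qed.

Definition opponent (i : player) : player := match i with I => II | II => I end.

Lemma ToMove_opponent i n : ToMove M (opponent i) n <-> ~ ToMove M i n.
Proof. destruct i; cbn; tauto. Qed.

Lemma WonBy_opponent i A f : WonBy M (opponent i) A f <-> ~ WonBy M i A f.
Proof. destruct i; cbn; tauto. Qed.

Theorem open_determined i A : (exists x, x ∈' X) -> OpenFor M i X A ->
  (exists T, WinningStrategy M i X A T) \/ (exists T, WinningStrategy M (opponent i) X A T).
Proof.
  intros [x0 Hx0] Open.
  set (won := fun s n => forall g, Fun M g omega X -> Restr M s g n -> WonBy M i A g).
  (* A won position has no successors, so it has rank zero; an illegal choice [a] loops, so it
     never decreases the rank. *)
  set (kappa := fun s a b => exists n, n ∈ omega /\ Fun M s n X /\ ~ won s n /\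
    ((ToMove M i n /\ ((a ∈' X /\ b = adjoin s (pair n a)) \/ (~ a ∈' X /\ b = s))) \/
     (~ ToMove M i n /\ exists y, y ∈' X /\ b = adjoin s (pair n y)))).
  destruct (stage_comparison kappa) as (W & L & H1 & H2 & H3).
  { unfold kappa, won. def. }
  assert (Irr : forall s, s ∈' W -> ~ pair s s ∈' L).
  { intros s Hs. destruct (H3 (fun p => p = s)) as (p & _ & -> & Hp); eauto. def. }
  (* Closure of [W] read contrapositively: outside [W], every choice has an answer that stays
     outside. *)
  assert (Esc : forall s a, ~ s ∈' W -> exists b, kappa s a b /\ ~ b ∈' W).
  { intros s a Hs. apply NNPP. intros N. apply Hs, H1. exists a. intros b Hb.
    apply NNPP. eauto. }
  destruct (classic (zero ∈' W)) as [W0|W0].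
  - left.
    destruct (strategy_ex (fun s x => forall n, n ∈ omega -> Fun M s n X -> ToMove M i n ->
      s ∈' W -> forall b, kappa s x b -> pair b s ∈' L /\ b ∈' W)) as (T & HT & HT').
    { unfold kappa, won. def. }
    { intros s n Hn Hs. destruct (classic (s ∈' W)) as [Ws|Ws]; [|exists x0; tauto].
      destruct (H2 s Ws) as [a Ha]. destruct (classic (a ∈' X)) as [Xa|Xa]; [eauto|].
      (* With [a] illegal, the position cannot be one that is not yet won and has [i] to move: the
         loop would put [s] below itself. The requirement on the default move [x0] is thus
         vacuous. *)
      exists x0. split; auto. intros n' Hn' Hs' Mv _ b (m & Hm & Hsm & Nw & _).
      rewrite (Fun_length Hs' Hsm) in Mv.
      destruct (Irr s Ws). apply (Ha s). exists m. eauto 8. }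
    exists T. split; auto. intros f Hf Fo. apply Play_iff in Hf. apply NNPP. intros Lost.
    (* No initial segment of a lost play is won. So each move lowers the rank: those of [i] by the
       strategy, those of the opponent because the choice given by [H2] covers every answer. *)
    assert (Step : forall n, n ∈ omega -> forall r r', Restr M r f n ->
      Restr M r' f (succ n) -> r ∈' W -> pair r' r ∈' L /\ r' ∈' W).
    { intros n Hn r r' Hr Hr' Wr. assert (Fr := Restr_Fun Hn Hf Hr).
      assert (Nw : ~ won r n) by (intros Wn; eauto).
      pose proof Hf as Hf'. apply Fun_iff in Hf'. destruct Hf' as [_ K].
      destruct (K n Hn) as [x Hx].
      assert (Xx : x ∈' X) by (apply (Fun_dom n x Hf); now apply Hx).
      assert (E := Restr_succ Hr Hr' Hx).
      destruct (classic (ToMove M i n)) as [Mv|Mv].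
      - destruct (Fo n) as (r1 & x1 & Hr1 & Hx1 & HTx); auto; [now apply InOmega_iff|].
        apply PairIn_iff, Hx in Hx1. subst x1. rewrite <- (Restr_unique Hr Hr1) in HTx.
        apply (HT' r x HTx n); auto. exists n. eauto 9.
      - destruct (H2 r Wr) as [a Ha]. apply Ha. exists n. eauto 9. }
    assert (All : forall n, n ∈ omega -> forall r, Restr M r f n -> r ∈' W).
    { apply (omega_induction (fun n => forall r, Restr M r f n -> r ∈' W)); [def| |].
      - intros r Hr. now rewrite (Restr_zero Hr).
      - intros n Hn IH r' Hr'. destruct (Restr_ex f n) as [r Hr].
        apply (Step n Hn r r'); auto. }
    (* An initial segment of least rank is contradicted by the next one. *)
    destruct (H3 (fun p => exists n, n ∈ omega /\ Restr M p f n))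
      as (p & Wp & (n & Hn & Hp) & Min).
    { def. }
    { destruct (Restr_ex f zero) as [r Hr]. exists r. split; eauto using zero_omega. }
    destruct (Restr_ex f (succ n)) as [r' Hr']. apply (Min r').
    + eauto using succ_omega.
    + now apply (Step n Hn p r').
  - right.
    destruct (strategy_ex (fun s x => forall n, n ∈ omega -> Fun M s n X ->
      ~ ToMove M i n -> ~ s ∈' W -> ~ adjoin s (pair n x) ∈' W)) as (T & HT & HT').
    { def. }
    { intros s n Hn Hs.
      destruct (classic (~ ToMove M i n /\ ~ s ∈' W)) as [[Mv Ws]|N].
      (* On the opponent's turn [kappa] does not depend on the choice, so [x0] is an arbitrary
         argument; the escaping answer is the move sought. *)
      - destruct (Esc s x0 Ws) as (b & (m & _ & Hm & _ & Hb) & Wb).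
        rewrite (Fun_length Hm Hs) in Hb.
        destruct Hb as [[Mv' _]|(_ & y & Xy & ->)]; [tauto|]. exists y. split; auto.
        intros n' _ Hs' _ _. now rewrite (Fun_length Hs' Hs).
      - exists x0. split; auto. intros n' _ Hs'. rewrite (Fun_length Hs' Hs). tauto. }
    exists T. split; auto. intros f Hf Fo. apply WonBy_opponent. intros Won.
    assert (Hf' := Hf). apply Play_iff in Hf.
    assert (All : forall n, n ∈ omega -> forall r, Restr M r f n -> ~ r ∈' W).
    { apply (omega_induction (fun n => forall r, Restr M r f n -> ~ r ∈' W)); [def| |].
      - intros r Hr. now rewrite (Restr_zero Hr).
      - intros n Hn IH r' Hr'. destruct (Restr_ex f n) as [r Hr].
        assert (Fr := Restr_Fun Hn Hf Hr). specialize (IH r Hr).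
        pose proof Hf as K. apply Fun_iff in K. destruct K as [_ K].
        destruct (K n Hn) as [x Hx]. rewrite (Restr_succ Hr Hr' Hx).
        assert (Xx : x ∈' X) by (apply (Fun_dom n x Hf); now apply Hx).
        destruct (classic (ToMove M i n)) as [Mv|Mv].
        (* The choice is the move [x] actually played by [i]; being legal, it admits only the
           resulting position as answer. *)
        + destruct (Esc r x IH) as (b & (m & _ & Hm & _ & Hb) & Wb).
          rewrite (Fun_length Hm Fr) in Hb.
          destruct Hb as [(_ & [[_ ->]|[N _]])|[N _]]; tauto.
        + destruct (Fo n) as (r1 & x1 & Hr1 & Hx1 & HTx);
            [now apply InOmega_iff|now apply ToMove_opponent|].
          apply PairIn_iff, Hx in Hx1. subst x1. rewrite <- (Restr_unique Hr Hr1) in HTx.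
          now apply (HT' r x HTx n). }
    destruct (Open f (conj Hf' Won)) as (n & r & Hn & Hr & Hg). apply InOmega_iff in Hn.
    (* Openness makes some initial segment of the play won. Nothing is related to it by [kappa], so
       any choice, here [zero], puts it into [W]. *)
    apply (All n Hn r Hr), H1. exists zero. intros b (m & _ & Hm & Nw & _).
    destruct Nw. rewrite (Fun_length Hm (Restr_Fun Hn Hf Hr)).
    intros g Fg Hrg. apply Hg. split; auto. now apply Play_iff.
Qed.

End Functions.

Theorem open_determinacy_holds : OpenDeterminacy M.
Proof.
  intros X A (HX & _ & Open). apply either_iff. apply either_iff in Open.
  destruct Open as [Open|Open]; apply open_determined in Open; tauto.
Qed.

End Model.

(** * The axioms are sentences; transfer from models to derivations *)

Lemma bounded_iter_SAll k q : forall n m, bounded (k + n) m q ->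
  bounded n m (Nat.iter k SAll q).
Proof.
  induction k; cbn; intros n m H; auto. apply IHk. now rewrite Nat.add_succ_r.
Qed.

Lemma bounded_iter_CAll k q : forall n m, bounded n (k + m) q ->
  bounded n m (Nat.iter k CAll q).
Proof.
  induction k; cbn; intros n m H; auto. apply IHk. now rewrite Nat.add_succ_r.
Qed.

Lemma bounded_ren p : forall n m n' m' f g, bounded n m p ->
  (forall i, i < n -> f i < n') -> (forall i, i < m -> g i < m') ->
  bounded n' m' (ren f g p).
Proof.
  induction p; cbn; intros n m n' m' f g B Hf Hg;
    repeat match goal with H : _ /\ _ |- _ => destruct H end; eauto 6.
  - eapply IHp; eauto. intros [|i] Hi; cbn; [lia|]. assert (f i < n') by (apply Hf; lia). lia.
  - eapply IHp; eauto. intros [|i] Hi; cbn; [lia|]. assert (g i < m') by (apply Hg; lia). lia.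
Qed.

Lemma bounded_comprehension k l p : bounded (S k) l p -> bounded 0 0 (comprehension k l p).
Proof.
  intros H. apply bounded_iter_SAll, bounded_iter_CAll. rewrite !Nat.add_0_r.
  assert (bounded (S k) (S l) (cshift p)).
  { eapply bounded_ren; eauto; unfold nid; intros; lia. }
  cbn. repeat split; auto; lia.
Qed.

Lemma GBC_Pi11_sentences : sentences GBC_Pi11.
Proof.
  intros p [[q H|k l q _ H]|[q _ H]]; try now apply bounded_comprehension.
  cbn in H. repeat destruct H as [<-|H]; try tauto; cbn; repeat split; lia.
Qed.

Theorem theorem8 :
  proves KM open_determinacy /\ proves GBC_Pi11 open_determinacy.
Proof.
  assert (H : proves GBC_Pi11 open_determinacy).
  { apply completeness.
    - exact GBC_Pi11_sentences.
    - cbn. repeat split; lia.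
    - intros M HM r s. apply open_determinacy_iff. now apply open_determinacy_holds. }
  split; auto. eapply prv_mono; [exact GBC_Pi11_subtheory_KM|exact H].
Qed.
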